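(* Let $X^+$ and $X^-$ be real Brownian motions begun at $0$ with constant drifts $+1$ and $-1$ respectively (and unit infinitesimal variance). Then a MEXIT coupling of $X^+$ and $X^-$ exists, and its MEXIT time is almost surely strictly positive.
   Context: A coupling of $X^+$ and $X^-$ is a pair $(\tilde X^+,\tilde X^-)$ of continuous processes on a common probability space such that $\tilde X^{\pm}$ has the law of $X^{\pm}$. For probability measures $\mu^+,\mu^-$ on the same measurable space, the meet $\mu^+\wedge\mu^-$ is the largest non-negative measure $\tilde\mu$ with $\tilde\mu(D)\le\min\{\mu^+(D),\mu^-(D)\}$ for all measurable $D$. The coupling is a MEXIT (maximal exit) coupling if for every $t>0$ the probability $\mathbb{P}[\tilde X^+(s)=\tilde X^-(s)\text{ for all }s<t]$ equals the total mass of $\mathcal{L}(X^+(s):0\le s<t)\wedge\mathcal{L}(X^-(s):0\le s<t)$, i.e. is the maximum possible over all couplings. The MEXIT time of such a coupling is $T=\inf\{t\ge0:\tilde X^+(t)\ne\tilde X^-(t)\}$. *)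

(* Defs.v *)
From HB Require Import structures.
From mathcomp Require Import all_boot all_order all_algebra.
From mathcomp Require Import all_classical all_reals all_analysis.

Set Implicit Arguments.
Unset Strict Implicit.
Unset Printing Implicit Defensive.

Import Order.TTheory GRing.Theory Num.Theory.
Import numFieldNormedType.Exports.

Local Open Scope classical_set_scope.
Local Open Scope ring_scope.

(* A real-valued process is a family [X : R -> {RV P >-> R}] indexed by all of
   [R]; only the times [0 <= t] are ever looked at. *)

Section paths.
Context {R : realType}.

Definition cylinders (D : set R) : set_system (D -> R) :=
  \bigcup_(s in [set: D])
    preimage_set_system setT (fun x : D -> R => x s) measurable.
Arguments cylinders : clear implicits.

(* [R^D] with the product sigma-algebra *)
Definition path_space (D : set R) := g_sigma_algebraType (cylinders D).

Context {d : measure_display} {Om : measurableType d} {P : probability Om R}.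
Implicit Types (X : R -> {RV P >-> R}) (D : set R).

Definition sample_path X D (w : Om) : path_space D := fun s => X (\val s) w.
Arguments sample_path : clear implicits.

Lemma measurable_sample_path X D : measurable_fun setT (sample_path X D).
Proof.
apply: (@measurability _ _ _ (path_space D) _ _ (cylinders D) erefl).
move=> _ [_ [s _ [B mB <-]] <-].
rewrite !setTI; have := @measurable_funPT _ _ _ _ (X (\val s)) measurableT B mB.
by rewrite setTI.
Qed.
Arguments measurable_sample_path : clear implicits.

HB.instance Definition _ X D :=
  isMeasurableFun.Build _ _ _ _ (sample_path X D) (measurable_sample_path X D).

Definition law X D : probability (path_space D) R :=
  distribution P (sample_path X D).
Arguments law : clear implicits.

Definition continuous_paths X :=
  forall w, {within `[0, +oo[, continuous (fun t => X t w)}.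

Definition increment X (s t : R) : Om -> R := X t \- X s.

Definition independent_increments X :=
  forall (n : nat) (t : nat -> R) (B : nat -> set R),
    0 <= t 0%N -> {homo t : i j / (i <= j)%N >-> i <= j} ->
    (forall i, measurable (B i)) ->
    P (\bigcap_(i in `I_n) increment X (t i) (t i.+1) @^-1` B i) =
      (\prod_(i < n) P (increment X (t i) (t i.+1) @^-1` B i))%E.

(* [X] is a real Brownian motion begun at [0], with constant drift [b] and unit
   infinitesimal variance. The second argument of [normal_prob] is the standard
   deviation. *)
Definition brownian_motion_with_drift (b : R) X :=
  [/\ forall w, X 0 w = 0,
      independent_increments X,
      forall s t (B : set R), 0 <= s -> s < t -> measurable B ->
        P (increment X s t @^-1` B) =
          normal_prob (b * (t - s)) (Num.sqrt (t - s)) B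
    & continuous_paths X].

End paths.

Definition is_meet d (T : measurableType d) (R : realType)
    (mu nu m : {measure set T -> \bar R}) :=
  let below (m' : {measure set T -> \bar R}) :=
    forall A, measurable A -> (m' A <= Order.min (mu A) (nu A))%E in
  below m /\
  forall m' : {measure set T -> \bar R}, below m' ->
    forall A, measurable A -> (m' A <= m A)%E.

Section mexit.
Context {R : realType}.
Context {dp : measure_display} {Omp : measurableType dp}
  {Pp : probability Omp R}.
Context {dm : measure_display} {Omm : measurableType dm}
  {Pm : probability Omm R}.
Context {d : measure_display} {Om : measurableType d} {P : probability Om R}.
Variables (Xp : R -> {RV Pp >-> R}) (Xm : R -> {RV Pm >-> R}).
Variables (Yp Ym : R -> {RV P >-> R}).

Definition is_coupling :=
  [/\ continuous_paths Yp, continuous_paths Ym,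
      forall A, measurable A -> law Yp `[0, +oo[ A = law Xp `[0, +oo[ A
    & forall A, measurable A -> law Ym `[0, +oo[ A = law Xm `[0, +oo[ A].

(* The agreement event is measurable because the paths of [Yp] and [Ym] are
   continuous. *)
Definition is_mexit_coupling :=
  is_coupling /\
  forall t : R, 0 < t ->
    exists m : {measure set (path_space `[0, t[) -> \bar R},
      is_meet (law Xp `[0, t[) (law Xm `[0, t[) m /\
      P [set w | forall s, 0 <= s < t -> Yp s w = Ym s w] = m setT.

(* The value is [+oo] when the two paths never separate. *)
Definition mexit_time (w : Om) : \bar R :=
  ereal_inf [set t%:E | t in [set t | 0 <= t /\ Yp t w <> Ym t w]].

End mexit.

(* Main.v *)
Require Import Defs.
From HB Require Import structures.
From mathcomp Require Import all_boot all_order all_algebra.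
From mathcomp Require Import all_classical all_reals all_analysis.
From mathcomp Require Import measurable_realfun ring lra.

Set Implicit Arguments.
Unset Strict Implicit.
Unset Printing Implicit Defensive.

Import Order.TTheory GRing.Theory Num.Theory.
Import numFieldNormedType.Exports.

Local Open Scope classical_set_scope.
Local Open Scope ring_scope.

(** The coupling is explicit. Let [X] be the Brownian motion with drift [1]. It
tends to infinity, so almost surely the times at which it is negative are
bounded. The partner of [X] follows [X] up to the supremum of these times and is
[- X] afterwards; it is continuous, because the change of sign happens at a zero
of [X].

The partner has the law of Brownian motion with drift [-1] ([partner_law]).
Two properties of Gaussian densities give this. The likelihood ratio of the
drift [-1] with respect to the drift [1] along a path from [x] to [z] is
[exp (-2 (z - x))] ([transition_tilt]). And the reflection [z |-> - z]
conjugates the kernel of the drift [1] to itself after multiplication by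
[exp (-2 z)] ([transition_reflect0]), which yields the kernel of the process
killed below [0] by the method of images. The latter is reached through random
walks on finer and finer grids ([iter_killed_cvg], [killed_prob]), so that no
stopping time is involved. For finitely many observations, let [o x] be the
probability that a path with drift [1] from [x] stays nonnegative while its
opposite makes the observations, [r x] the probability that it visits the
negatives and makes the observations once reflected after the last visit, and
[d x] the probability that a path with drift [-1] makes them. By induction on
the observations,
[r x + exp (-2 x) * o (- x) = exp (-2 x) * d x] ([reflected_opposite]). At
[x = 0] the killed kernel vanishes, so that [r 0 = d 0]. The signs of the
endpoints that this argument imposes disappear as the horizon tends to
infinity, because of the drifts ([partner_hits]).

The coupling is maximal ([meet_measureP]). Fix [t > 0] and a measure [m] below
both laws on the paths over [0 <= s < t]. By continuity such a path determines
the sign of its endpoint. On the paths that end negative, [m] is below the law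
of [X], and a path of [X] that ends negative still agrees with its partner. On
the others, [m] is below the law of the partner, and a partner that ends
nonnegative has almost surely not been reflected yet, so it agrees with [X].
Hence [m] is below the law of [X] on the event of agreement, and this law is the
meet.

The exit time is positive ([mexit_time_gt0]). The probability of agreement
before [t] is the mass of the meet, whatever the coupling. For the coupling
above, disagreement before [t] forces [X] to be nonnegative on [t, oo), and this
has a probability that tends, as [t] tends to [0], to that of [X] being
nonnegative forever, which is zero ([nonneg_null]). *)


(** * Gaussian integrals *)

Section gaussian.
Context {R : realType}.
Local Notation mu := (@lebesgue_measure R).
Implicit Types (m s x y : R) (F : R -> \bar R).
Local Open Scope ereal_scope.

(** The density of [normal_prob] is its Radon-Nikodym derivative, almost
everywhere. *)
Lemma ge0_integral_normal_prob m s F :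
  measurable_fun setT F -> (forall x, 0 <= F x) ->
  \int[normal_prob m s]_x F x =
  \int[mu]_x (F x * (normal_pdf m s x)%:E).
Proof.
move=> mF F0; have Pmu := normal_prob_dominates m s.
rewrite -(Radon_Nikodym_SigmaFinite.change_of_variables Pmu)//.
have mpdf : measurable_fun setT (EFin \o normal_pdf m s).
  by apply/measurable_EFinP; exact: measurable_normal_pdf.
have iRN := Radon_Nikodym_SigmaFinite.f_integrable Pmu.
apply: ge0_ae_eq_integral => //.
- apply: emeasurable_funM => //; exact: measurable_int iRN.
- exact: emeasurable_funM.
- by move=> x _; rewrite mule_ge0 ?Radon_Nikodym_SigmaFinite.f_ge0.
- by move=> x _; rewrite mule_ge0 ?lee_fin ?normal_pdf_ge0.
apply: ae_eqe_mul2l; apply: integral_ae_eq => //.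
by move=> E _ mE; rewrite -Radon_Nikodym_SigmaFinite.f_integral.
Qed.

Lemma lebesgue_measureD x (A : set R) : measurable A ->
  pushforward mu ((fun y => x + y)%R : _ -> measurableTypeR R) A = mu A.
Proof.
move=> mA; apply/esym/lebesgue_measure_unique => //=.
  exact: measurable_funD.
move=> _ _ [[a b]] _ <-; rewrite /pushforward /=.
have -> : ((fun y : R => (x + y)%R) @^-1` `]a, b])%classic =
    `](a - x)%R, (b - x)%R]%classic.
  by apply/seteqP; split => y /=; rewrite !in_itv /= => /andP[? ?];
    apply/andP; split; lra.
rewrite !lebesgue_measure_itv/= !lte_fin ltrD2r.
by case: ifP => // _; congr EFin; lra.
Qed.

Lemma ge0_integral_lebesgueD x F :
  measurable_fun setT F -> (forall y, 0 <= F y) ->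
  \int[mu]_y F (x + y)%R = \int[mu]_y F y.
Proof.
move=> mF F0.
have mx : measurable_fun setT ((fun y => x + y)%R : R -> measurableTypeR R).
  exact: measurable_funD.
rewrite [RHS](eq_measure_integral (pushforward mu
    ((fun y => x + y)%R : _ -> measurableTypeR R))); last first.
  by move=> A mA _; exact/esym/lebesgue_measureD.
by rewrite ge0_integral_pushforward.
Qed.

Lemma ge0_integral_lebesgueN F :
  measurable_fun setT F -> (forall y, 0 <= F y) ->
  \int[mu]_y F (- y)%R = \int[mu]_y F y.
Proof.
move=> mF F0.
rewrite [RHS](eq_measure_integral (pushforward mu
    (-%R : _ -> measurableTypeR R))); last first.
  by move=> A mA _; exact/esym/lebesgue_measureN.
by rewrite ge0_integral_pushforward.
Qed.

Lemma ge0_integral_lebesgueB x F :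
  measurable_fun setT F -> (forall y, 0 <= F y) ->
  \int[mu]_y F (x - y)%R = \int[mu]_y F y.
Proof.
move=> mF F0; rewrite -[RHS](ge0_integral_lebesgueD x mF F0).
rewrite -[RHS]ge0_integral_lebesgueN//.
by apply: measurableT_comp mF _; exact: measurable_funD.
Qed.

Lemma normal_pdfD m s x z : s != 0%R ->
  normal_pdf (x + m) s (x + z)%R = normal_pdf m s z.
Proof.
move=> s0; rewrite !normal_pdfE// /normal_fun.
by have -> : (x + z - (x + m) = z - m)%R by lra.
Qed.

Lemma normal_pdfN m s z : s != 0%R ->
  normal_pdf (- m) s (- z)%R = normal_pdf m s z.
Proof.
move=> s0; rewrite !normal_pdfE// /normal_fun.
have -> : (- z - - m = - (z - m))%R by rewrite opprD.
by rewrite sqrrN.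
Qed.

(** Exponential tilting of a Gaussian is a change of mean; this is the
one-step form of the Girsanov density. *)
Lemma normal_pdf_tilt l m s z : s != 0%R ->
  normal_pdf (m + l * s ^+ 2) s z =
  (expR (l * (z - m) - l ^+ 2 * s ^+ 2 / 2) * normal_pdf m s z)%R.
Proof.
move=> s0; rewrite !normal_pdfE// [RHS]mulrCA /normal_fun -expRD.
congr (_ * expR _)%R.
by field.
Qed.

End gaussian.

(** * The transition kernel of drifted Brownian motion *)

Lemma measurable_patch {R : realType} d (T : measurableType d)
    (F : T -> \bar R) (B : set T) : measurable B ->
  measurable_fun [set: T] F -> measurable_fun [set: T] (F \_ B).
Proof.
by move=> mB mF; apply/(measurable_restrictT _ mB); exact: measurable_funTS.
Qed.

Section kernel.
Context {R : realType}.
Local Notation mu := (@lebesgue_measure R).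
Implicit Types (b c h x y z : R) (F G : R -> \bar R).
Local Open Scope ereal_scope.

(** Indicators lie in this class, and the kernels preserve it; the upper bound
provides integrability. *)
Definition unit_fun F := measurable_fun [set: R] F /\ forall x, 0 <= F x <= 1.

Definition transition b h F x : \bar R :=
  \int[normal_prob (x + b * h) (Num.sqrt h)]_z F z.

Lemma unit_fun_ge0 F : unit_fun F -> forall x, 0 <= F x.
Proof. by move=> [_ F01] x; case/andP: (F01 x). Qed.

Lemma unit_fun_le1 F : unit_fun F -> forall x, F x <= 1.
Proof. by move=> [_ F01] x; case/andP: (F01 x). Qed.

Lemma unit_fun_fin_num F : unit_fun F -> forall x, F x \is a fin_num.
Proof.
move=> uF x; rewrite ge0_fin_numE ?unit_fun_ge0//.
by rewrite (le_lt_trans (unit_fun_le1 uF x)) ?ltry.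
Qed.

Lemma unit_fun_restrict F (B : set R) :
  measurable B -> unit_fun F -> unit_fun (F \_ B).
Proof.
move=> mB [mF F01]; split.
  exact: measurable_patch.
by move=> x; rewrite /patch; case: ifP => _//; rewrite lexx lee01.
Qed.

Lemma unit_fun1 : unit_fun (cst 1).
Proof. by split=> // x; rewrite lexx lee01. Qed.

Lemma ge0_transitionE b h F x : measurable_fun [set: R] F ->
  (forall z, 0 <= F z) ->
  transition b h F x =
  \int[mu]_z (F z * (normal_pdf (x + b * h) (Num.sqrt h) z)%:E).
Proof. by move=> mF F0; rewrite /transition ge0_integral_normal_prob. Qed.

Lemma sqrt_neq0 h : (0 < h)%R -> Num.sqrt h != 0%R.
Proof. by move=> h0; rewrite gt_eqF// sqrtr_gt0. Qed.

Lemma ge0_mul_pdf m s F : (forall z, 0 <= F z) ->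
  forall z, 0 <= F z * (normal_pdf m s z)%:E.
Proof. by move=> F0 z; rewrite mule_ge0// lee_fin normal_pdf_ge0. Qed.

Lemma ge0_integralZ_pdf a m s F : measurable_fun [set: R] F ->
  (forall z, 0 <= F z) ->
  \int[mu]_z ((expR a)%:E * (F z * (normal_pdf m s z)%:E)) =
  (expR a)%:E * \int[mu]_z (F z * (normal_pdf m s z)%:E).
Proof.
move=> mF F0; apply: ge0_integralZl => //.
- apply: emeasurable_funM => //.
  by apply/measurable_EFinP; exact: measurable_normal_pdf.
- by move=> z _; exact: ge0_mul_pdf.
Qed.

Lemma transition_incr b h F x : (0 < h)%R -> measurable_fun [set: R] F ->
  (forall z, 0 <= F z) ->
  transition b h F x = \int[normal_prob (b * h) (Num.sqrt h)]_z F (x + z)%R.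
Proof.
move=> h0 mF F0; have s0 := sqrt_neq0 h0.
have mpdf m : measurable_fun setT (EFin \o normal_pdf m (Num.sqrt h)).
  by apply/measurable_EFinP; exact: measurable_normal_pdf.
have mFx : measurable_fun [set: R] (fun z => F (x + z)%R).
  by apply: measurableT_comp mF _; exact: measurable_funD.
rewrite (ge0_transitionE _ _ _ mF F0).
rewrite [RHS](ge0_integral_normal_prob _ _ mFx (fun z => F0 _)).
have mFp := emeasurable_funM mF (mpdf (x + b * h)%R).
rewrite -(ge0_integral_lebesgueD x mFp (ge0_mul_pdf _ _ F0)).
by apply: eq_integral => z _ /=; rewrite (normal_pdfD _ _ _ s0).
Qed.

Lemma measurable_transition b h F : (0 < h)%R -> measurable_fun [set: R] F ->
  (forall z, 0 <= F z) -> measurable_fun [set: R] (transition b h F).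
Proof.
move=> h0 mF F0.
have -> : transition b h F = fubini_F (normal_prob (b * h) (Num.sqrt h))
    (fun z : R * measurableTypeR R => F (z.1 + z.2)%R).
  by apply/funext => x; rewrite transition_incr.
apply: measurable_fun_fubini_tonelli_F; last by move=> z; exact: F0.
by apply: measurableT_comp mF _; exact: measurable_funD.
Qed.

Lemma transition_ge0 b h F x : (forall z, 0 <= F z) -> 0 <= transition b h F x.
Proof. by move=> F0; apply: integral_ge0. Qed.

Lemma le_transition b h F G x :
  measurable_fun [set: R] F -> measurable_fun [set: R] G ->
  (forall z, 0 <= F z) -> (forall z, F z <= G z) ->
  transition b h F x <= transition b h G x.
Proof.
by move=> mF mG F0 FG; apply: ge0_le_integral.
Qed.

Lemma transition_cst b h (r : \bar R) x : transition b h (cst r) x = r.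
Proof. by rewrite /transition integral_cst//= probability_setT mule1. Qed.

Lemma transition_unit b h F : (0 < h)%R -> unit_fun F ->
  unit_fun (transition b h F).
Proof.
move=> h0 uF; split.
  by apply: measurable_transition => //; [case: uF|exact: unit_fun_ge0].
move=> x; rewrite transition_ge0//=; last exact: unit_fun_ge0.
have : transition b h F x <= transition b h (cst 1) x.
  by apply: le_transition => //; [case: uF|exact: unit_fun_ge0|exact: unit_fun_le1].
by rewrite transition_cst.
Qed.

Lemma transitionD b h F G x :
  measurable_fun [set: R] F -> measurable_fun [set: R] G ->
  (forall z, 0 <= F z) -> (forall z, 0 <= G z) ->
  transition b h (F \+ G) x = transition b h F x + transition b h G x.
Proof. by move=> *; rewrite /transition ge0_integralD. Qed.

(** The likelihood ratio of the drifts [-1] and [1] over a time step from [x]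
to [z] is [exp (-2 (z - x))]: it does not depend on the length of the step, so
it telescopes along a path. *)
Lemma transition_tilt h F x : (0 < h)%R -> measurable_fun [set: R] F ->
  (forall z, 0 <= F z) ->
  transition 1 h (fun z => (expR (- 2 * z))%:E * F z) x =
  (expR (- 2 * x))%:E * transition (- 1) h F x.
Proof.
move=> h0 mF F0; have s0 := sqrt_neq0 h0.
have mexp : measurable_fun [set: R] (fun z => (expR (- 2 * z))%:E).
  by apply/measurable_EFinP; exact: measurableT_comp.
have mpdf m : measurable_fun setT (EFin \o normal_pdf m (Num.sqrt h)).
  by apply/measurable_EFinP; exact: measurable_normal_pdf.
rewrite (ge0_transitionE _ _ _ mF F0) ge0_transitionE; last 2 first.
- exact: emeasurable_funM mexp mF.
- by move=> z; rewrite mule_ge0// lee_fin expR_ge0.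
rewrite -(ge0_integralZ_pdf _ _ _ mF F0).
apply: eq_integral => z _; rewrite (muleC _ (F z)) -muleA.
rewrite [in RHS]muleCA; congr (_ * _); rewrite -!EFinM; congr EFin.
have -> : (x + 1 * h = x + -1 * h + 2 * Num.sqrt h ^+ 2)%R.
  by rewrite sqr_sqrtr ?ltW//; lra.
rewrite normal_pdf_tilt// mulrA -expRD sqr_sqrtr ?ltW//.
by congr (expR _ * _)%R; field.
Qed.

(** Reflection at the level [c] exchanges the drifts [1] and [-1]; the weight
[exp (-2 (z - c))], harmonic for the drift [1], exchanges them back. *)
Lemma transition_reflect c h F x : (0 < h)%R -> measurable_fun [set: R] F ->
  (forall z, 0 <= F z) ->
  transition 1 h (fun z => (expR (- 2 * (z - c)))%:E * F (2 * c - z)%R) x =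
  (expR (- 2 * (x - c)))%:E * transition 1 h F (2 * c - x)%R.
Proof.
move=> h0 mF F0; have s0 := sqrt_neq0 h0.
have mexp : measurable_fun [set: R] (fun z => (expR (- 2 * (z - c)))%:E).
  apply/measurable_EFinP; apply: (measurableT_comp (@measurable_expR R)).
  by apply: measurable_funM => //; exact: measurable_funB.
have mFc : measurable_fun [set: R] (fun z => F (2 * c - z)%R).
  by apply: measurableT_comp mF _; exact: measurable_funB.
have mpdf m : measurable_fun setT (EFin \o normal_pdf m (Num.sqrt h)).
  by apply/measurable_EFinP; exact: measurable_normal_pdf.
rewrite (ge0_transitionE _ _ _ mF F0) ge0_transitionE; last 2 first.
- exact: emeasurable_funM mexp mFc.
- by move=> z; rewrite mule_ge0// lee_fin expR_ge0.
rewrite -[X in _ = _ * X](ge0_integral_lebesgueB (2 * c)%R); last 2 first.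
- exact: emeasurable_funM mF (mpdf _).
- exact: ge0_mul_pdf.
under [X in _ = _ * X]eq_integral => z _.
  have -> : (2 * c - x + 1 * h = 2 * c + (- (x - h)))%R by lra.
  rewrite (normal_pdfD _ _ _ s0) (normal_pdfN _ _ s0); over.
rewrite -(ge0_integralZ_pdf _ _ _ mFc (fun z => F0 _)).
apply: eq_integral => z _; rewrite (muleC _ (F _)) -muleA.
rewrite [in RHS]muleCA; congr (_ * _); rewrite -!EFinM; congr EFin.
have -> : (x + 1 * h = x - h + 2 * Num.sqrt h ^+ 2)%R.
  by rewrite sqr_sqrtr ?ltW//; lra.
rewrite normal_pdf_tilt// mulrA -expRD sqr_sqrtr ?ltW//.
by congr (expR _ * _)%R; field.
Qed.

Lemma transition_reflect0 h F x : (0 < h)%R -> measurable_fun [set: R] F ->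
  (forall z, 0 <= F z) ->
  transition 1 h (fun z => (expR (- 2 * z))%:E * F (- z)%R) x =
  (expR (- 2 * x))%:E * transition 1 h F (- x)%R.
Proof.
move=> h0 mF F0; have x0 : (x - 0 = x)%R by exact: subr0.
have x1 : (2 * 0 - x = - x)%R by rewrite mulr0 sub0r.
have := transition_reflect 0 x h0 mF F0; rewrite {}x0 {}x1; apply: etrans.
apply: eq_integral => z _; congr ((expR (_ * _))%:E * F _).
  exact/esym/subr0.
by rewrite mulr0 sub0r.
Qed.

Lemma measurable_reflect F : measurable_fun [set: R] F ->
  measurable_fun [set: R] (fun z => (expR (- 2 * z))%:E * F (- z)%R).
Proof.
move=> mF; apply: emeasurable_funM.
  by apply/measurable_EFinP; apply: measurableT_comp (@measurable_expR R) _.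
by apply: measurableT_comp mF _.
Qed.

(** The ratio of the densities of arrival at [z] from the mirror point and from
[y], with the harmonic weight, is at most [1] exactly when [y] and [z] lie on
the same side of [c]. *)
Lemma normal_pdf_reflect c h y z : (0 < h)%R ->
  (expR (- 2 * (y - c)) * normal_pdf (2 * c - y + 1 * h) (Num.sqrt h) z =
   expR (- 2 * (y - c) * (z - c) / h) *
     normal_pdf (y + 1 * h) (Num.sqrt h) z)%R.
Proof.
move=> h0; have s0 := sqrt_neq0 h0; have hn0 : h != 0%R by rewrite gt_eqF.
have -> : (2 * c - y + 1 * h =
    y + 1 * h + (2 * (c - y) / h) * Num.sqrt h ^+ 2)%R.
  by rewrite sqr_sqrtr ?ltW//; field.
rewrite normal_pdf_tilt// mulrA -expRD sqr_sqrtr ?ltW//.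
by congr (expR _ * _)%R; field.
Qed.

(** For a target above the level [c], starting above [c] beats starting at the
mirror point, once the harmonic weight is taken into account. *)
Lemma transition_reflect_le c h F y : (0 < h)%R -> measurable_fun [set: R] F ->
  (forall z, 0 <= F z) -> (forall z, (z < c)%R -> F z = 0) -> (c <= y)%R ->
  (expR (- 2 * (y - c)))%:E * transition 1 h F (2 * c - y)%R <=
  transition 1 h F y.
Proof.
move=> h0 mF F0 Fc cy.
have mpdf m : measurable_fun setT (EFin \o normal_pdf m (Num.sqrt h)).
  by apply/measurable_EFinP; exact: measurable_normal_pdf.
rewrite !(ge0_transitionE _ _ _ mF F0) -(ge0_integralZ_pdf _ _ _ mF F0).
apply: ge0_le_integral => //.
- move=> z _; rewrite mule_ge0 ?lee_fin ?expR_ge0//.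
  by rewrite mule_ge0// lee_fin normal_pdf_ge0.
- apply: emeasurable_funM; first exact: measurable_cst.
  exact: emeasurable_funM mF (mpdf _).
- exact: emeasurable_funM mF (mpdf _).
move=> z _; have [zc|cz] := ltP z c; first by rewrite Fc// !mul0e mule0.
rewrite muleCA lee_wpmul2l// -EFinM lee_fin normal_pdf_reflect//.
rewrite ler_piMl ?normal_pdf_ge0// -expR0 ler_expR.
rewrite !mulNr oppr_le0 divr_ge0 ?(ltW h0)// mulr_ge0 ?subr_ge0//.
by rewrite mulr_ge0// subr_ge0.
Qed.

End kernel.

(** * Reflection for a drifted random walk killed below zero *)

Section semigroup.
Context {R : realType}.
Local Notation mu := (@lebesgue_measure R).
Implicit Types (b m s t x y z : R) (F : R -> \bar R).

Lemma normal_peakM s t : 0 < s -> 0 < t ->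
  normal_peak (Num.sqrt s) * normal_peak (Num.sqrt t) =
  normal_peak (Num.sqrt (s + t)) * normal_peak (Num.sqrt (s * t / (s + t))).
Proof.
move=> s0 t0; have st0 : 0 < s + t by rewrite addr_gt0.
have p0 : 0 < pi :> R by exact: pi_gt0.
rewrite /normal_peak !sqr_sqrtr ?divr_ge0 ?mulr_ge0 ?addr_ge0 ?ltW//.
rewrite -!invfM -!sqrtrM ?mulrn_wge0 ?mulr_ge0 ?ltW//.
congr (Num.sqrt _)^-1; field.
by rewrite gt_eqF.
Qed.

(** Completing the square: the Gaussian bridge. *)
Lemma normal_pdf_bridge m1 m2 s t y z : 0 < s -> 0 < t ->
  normal_pdf m1 (Num.sqrt s) y * normal_pdf (y + m2) (Num.sqrt t) z =
  normal_pdf (m1 + m2) (Num.sqrt (s + t)) z *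
  normal_pdf ((t * m1 + s * (z - m2)) / (s + t)) (Num.sqrt (s * t / (s + t))) y.
Proof.
move=> s0 t0; have st0 : 0 < s + t by rewrite addr_gt0.
have q0 : 0 < s * t / (s + t) by rewrite divr_gt0// mulr_gt0.
rewrite !normal_pdfE ?gt_eqF ?sqrtr_gt0//.
rewrite mulrACA normal_peakM// [RHS]mulrACA; congr (_ * _).
rewrite /normal_fun -!expRD !sqr_sqrtr ?ltW//; congr expR.
by field; rewrite !gt_eqF.
Qed.

Local Open Scope ereal_scope.

(** Integrating the Gaussian bridge over its middle point leaves the density of
the longer step. *)
Lemma transition_transition b s t F x : (0 < s)%R -> (0 < t)%R -> unit_fun F ->
  transition b s (transition b t F) x = transition b (s + t) F x.
Proof.
move=> s0 t0 uF; have mF := proj1 uF; have F0 := unit_fun_ge0 uF.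
have uK := transition_unit b t0 uF.
have mpdf m r : measurable_fun setT (EFin \o normal_pdf m r).
  by apply/measurable_EFinP; exact: measurable_normal_pdf.
have st0 : (0 < s + t)%R by rewrite addr_gt0.
rewrite (ge0_transitionE _ _ _ (proj1 uK) (unit_fun_ge0 uK)).
rewrite (ge0_transitionE _ _ _ mF F0).
pose f (w : R * R) := F w.2 * (normal_pdf (x + b * s) (Num.sqrt s) w.1 *
  normal_pdf (w.1 + b * t) (Num.sqrt t) w.2)%:E.
transitivity (\int[mu]_y \int[mu]_z f (y, z)).
  apply: eq_integral => y _; rewrite (ge0_transitionE _ _ _ mF F0) muleC.
  rewrite -ge0_integralZl//; last 3 first.
  - exact: emeasurable_funM mF (mpdf _ _).
  - by move=> z _; exact: ge0_mul_pdf.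
  - by rewrite lee_fin normal_pdf_ge0.
  by apply: eq_integral => z _; rewrite /f /= muleCA EFinM.
rewrite (@fubini_tonelli _ _ (measurableTypeR R) (measurableTypeR R) R mu mu f).
- apply: eq_integral => z _; rewrite /f /=.
  set m := ((t * (x + b * s) + s * (z - b * t)) / (s + t))%R.
  transitivity (\int[mu]_y (F z *
      (normal_pdf (x + b * (s + t)) (Num.sqrt (s + t)) z)%:E *
      (normal_pdf m (Num.sqrt (s * t / (s + t))) y)%:E)).
    apply: eq_integral => y _; rewrite normal_pdf_bridge// EFinM muleA.
    by have -> : (x + b * s + b * t = x + b * (s + t))%R by lra.
  rewrite ge0_integralZl//.
  + by rewrite integral_normal_pdf mule1.
  + exact: (mpdf m _).
  + by move=> y _; rewrite lee_fin normal_pdf_ge0.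
  + exact: ge0_mul_pdf.
- apply: emeasurable_funM; first exact: measurableT_comp mF measurable_snd.
  apply/measurable_EFinP; apply: measurable_funM.
    exact: measurableT_comp (measurable_normal_pdf _ _) measurable_fst.
  rewrite (_ : (fun _ => _) = (fun w : R * R =>
      normal_pdf (b * t) (Num.sqrt t) (w.2 - w.1))); last first.
    apply/funext => w; rewrite -[RHS](normal_pdfD _ w.1) ?sqrt_neq0//.
    by have -> : (w.1 + (w.2 - w.1) = w.2)%R by lra.
  apply: measurableT_comp (measurable_normal_pdf _ _) _.
  exact: measurable_funB measurable_snd measurable_fst.
- by move=> w; rewrite /f mule_ge0// lee_fin mulr_ge0// normal_pdf_ge0.
Qed.

End semigroup.

Section killed_walk.
Context {R : realType}.
Implicit Types (c d e h x y z L : R) (F : R -> \bar R) (n p : nat).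
Local Open Scope ereal_scope.
Local Notation step d := (transition 1 d).

Definition killed_step d F := step d F \_ `[0%R, +oo[.

Lemma killed_stepE d F x : (0 <= x)%R -> killed_step d F x = step d F x.
Proof. by move=> x0; rewrite /killed_step patchE mem_set//= in_itv/= x0. Qed.

Lemma killed_step0 d F x : (x < 0)%R -> killed_step d F x = 0.
Proof.
move=> x0; rewrite /killed_step patchE memNset//=.
by rewrite in_itv/= andbT; apply/negP; rewrite -ltNge.
Qed.

Lemma iter_step d F n : (0 < d)%R -> unit_fun F ->
  iter n.+1 (step d) F = step (n.+1%:R * d) F.
Proof.
move=> d0 uF; elim: n => [|n IH]; first by rewrite mul1r.
have nd0 : (0 < n.+1%:R * d)%R by rewrite mulr_gt0.
rewrite iterS IH; apply/funext => x.
have nE : (d + n.+1%:R * d = n.+2%:R * d)%R.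
  by rewrite -[in RHS]natr1 mulrDl mul1r addrC.
by rewrite (transition_transition _ _ d0 nd0 uF) nE.
Qed.

Lemma unit_fun_iter_step d F n : (0 < d)%R -> unit_fun F ->
  unit_fun (iter n (step d) F).
Proof. by move=> d0 uF; elim: n => //= n; exact: transition_unit. Qed.

Lemma unit_fun_iter_killed d F n : (0 < d)%R -> unit_fun F ->
  unit_fun (iter n (killed_step d) F).
Proof.
move=> d0 uF; elim: n => //= n uI; apply: unit_fun_restrict => //.
exact: transition_unit.
Qed.

Lemma iter_step_reflect_le d F n c y : (0 < d)%R -> unit_fun F ->
  (forall z, (z < 0)%R -> F z = 0) -> (c <= 0)%R -> (c <= y)%R ->
  (expR (- 2 * (y - c)))%:E * iter n (step d) F (2 * c - y)%R <=
  iter n (step d) F y.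
Proof.
move=> d0 uF F0 c0 cy; case: n => [|n].
  have [->|yc] := eqVneq y c.
    have -> : (2 * c - c = c)%R by lra.
    by rewrite subrr mulr0 expR0 mul1e.
  have cy' : (c < y)%R by rewrite lt_neqAle eq_sym yc.
  by rewrite /= F0 ?mule0 ?unit_fun_ge0//; lra.
rewrite iter_step//; apply: transition_reflect_le => //.
- by rewrite mulr_gt0.
- exact: (proj1 uF).
- exact: unit_fun_ge0.
- by move=> z zc; apply: F0; lra.
Qed.

(** Killing loses at most what the reflected walk collects. The overshoot below
[0] works in favour of this inequality. *)
Lemma iter_killed_ge d F n x : (0 < d)%R -> unit_fun F ->
  (forall z, (z < 0)%R -> F z = 0) ->
  iter n (step d) F x <= iter n (killed_step d) F x +
    (expR (- 2 * x))%:E * iter n (step d) F (- x)%R.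
Proof.
move=> d0 uF F0; elim: n x => [|n IH] x.
  by rewrite /= leeDl// mule_ge0 ?lee_fin ?expR_ge0// unit_fun_ge0.
have [x0|x0] := ltP x 0%R; last first.
  have uI := unit_fun_iter_step n d0 uF.
  have uK := unit_fun_iter_killed n d0 uF.
  rewrite ![iter n.+1 _ _]iterS killed_stepE//.
  rewrite -(transition_reflect0 x d0 (proj1 uI) (unit_fun_ge0 uI)).
  have mE := measurable_reflect (proj1 uI).
  have E0 z : 0 <= (expR (- 2 * z))%:E * iter n (step d) F (- z)%R.
    by rewrite mule_ge0 ?lee_fin ?expR_ge0// unit_fun_ge0.
  rewrite -transitionD//; [|exact: (proj1 uK)|exact: unit_fun_ge0].
  apply: le_transition => //; [exact: (proj1 uI)| |].
  - apply: emeasurable_funD mE; exact: (proj1 uK).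
  - exact: unit_fun_ge0.
have x0' : (0 <= - x)%R by lra.
have := iter_step_reflect_le n.+1 d0 uF F0 (lexx 0%R) x0'.
rewrite mulr0 sub0r opprK subr0 => H.
apply: (@le_trans _ _ ((expR (- 2 * x))%:E * iter n.+1 (step d) F (- x)%R)).
  have -> : iter n.+1 (step d) F x = (expR (- 2 * x))%:E *
      ((expR (- 2 * - x))%:E * iter n.+1 (step d) F x).
    by rewrite muleA -EFinM -expRD -mulrDr subrr mulr0 expR0 mul1e.
  by rewrite lee_wpmul2l// lee_fin expR_ge0.
rewrite leeDr//; exact: (unit_fun_ge0 (unit_fun_iter_killed _ _ _)).
Qed.

(** The Chernoff bound; the sign of [L] selects the tail. *)
Lemma normal_prob_tail L m (s : R) x (A : set R) : s != 0%R -> measurable A ->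
  (forall z, A z -> (L * x <= L * z)%R) ->
  normal_prob m s A <= (expR (- (L * (x - m)) + L ^+ 2 * s ^+ 2 / 2))%:E.
Proof.
move=> s0 mA AL; rewrite /normal_prob.
set a := (X in _ <= X%:E).
have mpdf m' : measurable_fun setT (EFin \o normal_pdf m' s).
  by apply/measurable_EFinP; exact: measurable_normal_pdf.
apply: (@le_trans _ _ (\int[lebesgue_measure]_(z in A)
    (a%:E * (normal_pdf (m + L * s ^+ 2) s z)%:E))).
  apply: ge0_le_integral => //.
  - by move=> z _; rewrite lee_fin normal_pdf_ge0.
  - exact: measurable_funTS (mpdf m).
  - apply: measurable_funTS; apply: emeasurable_funM (mpdf _).
    exact: measurable_cst.
  - move=> z Az; rewrite -EFinM lee_fin normal_pdf_tilt// mulrA -expRD.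
    rewrite ler_peMl ?normal_pdf_ge0// -expR0 ler_expR /a.
    have := AL z Az; lra.
have a0 : 0 <= a%:E by rewrite lee_fin expR_ge0.
rewrite ge0_integralZl//; last 2 first.
- exact: measurable_funTS (mpdf _).
- by move=> z _; rewrite lee_fin normal_pdf_ge0.
rewrite -[leRHS]mule1 lee_wpmul2l//.
exact: (@probability_le1 _ _ _ (normal_prob (m + L * s ^+ 2) s)).
Qed.

(** The converse bound reflects at the level [-e], which the walk can only miss
by a jump of size [e]; the last term bounds the probability of such jumps. *)
Lemma iter_killed_le d e L F n x : (0 < d)%R -> (0 < e)%R -> (0 <= L)%R ->
  unit_fun F -> (forall z, (z < 0)%R -> F z = 0) -> (0 <= x)%R ->
  iter n (killed_step d) F x +
    (expR (- 2 * (x + e)))%:E * iter n (step d) F (- (2 * e + x))%R <=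
  iter n (step d) F x +
    (n%:R * expR (- (L * (e - d)) + L ^+ 2 * d / 2))%:E.
Proof.
move=> d0 e0 L0 uF F0; set eta := expR (_ + _).
pose A := `](- e)%R, +oo[%classic : set R.
have mA : measurable A by exact: measurable_itv.
elim: n x => [|n IH] x x0.
  rewrite /= (F0 (- _)%R); last by lra.
  by rewrite mule0 adde0 mul0r adde0.
have uI := unit_fun_iter_step n d0 uF.
have uK := unit_fun_iter_killed n d0 uF.
have uA : unit_fun (cst 1 \_ A) by apply: unit_fun_restrict => //; exact: unit_fun1.
pose rfl G z := (expR (- 2 * (z - - e)))%:E * G (2 * - e - z)%R.
have mrfl G : unit_fun G -> measurable_fun [set: R] (rfl G).
  move=> uG; apply: emeasurable_funM.
    apply/measurable_EFinP; apply: (measurableT_comp (@measurable_expR R)).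
    by apply: measurable_funM => //; exact: measurable_funB.
  by apply: measurableT_comp (proj1 uG) _; exact: measurable_funB.
have rfl0 G : unit_fun G -> forall z, 0 <= rfl G z.
  by move=> uG z; rewrite mule_ge0 ?lee_fin ?expR_ge0// unit_fun_ge0.
have stepr G z : unit_fun G -> step d (rfl G) z = rfl (step d G) z.
  move=> uG; exact: transition_reflect (proj1 uG) (unit_fun_ge0 uG).
(* Nonnegative points are covered by the induction hypothesis and points between
   [- e] and [0] by domination under reflection; a point below [- e] is reached
   only by a jump, which the indicator of [A] at the mirror point records. *)
have IH' z : iter n (killed_step d) F z + rfl (iter n (step d) F) z <=
    iter n (step d) F z + (cst (n%:R * eta)%:E \+ rfl (cst 1 \_ A)) z.
  have n0 : 0 <= (n%:R * eta)%:E by rewrite lee_fin mulr_ge0// expR_ge0.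
  have [z0|z0] := leP 0%R z.
    have := IH z z0; rewrite /rfl opprK.
    have -> : (2 * - e - z = - (2 * e + z))%R by lra.
    move=> /le_trans -> //; rewrite leeD2l//= leeDl//.
    by rewrite mule_ge0 ?lee_fin ?expR_ge0// unit_fun_ge0.
  have -> : iter n (killed_step d) F z = 0.
    by case: (n) => [|k]; [exact: F0|exact: killed_step0].
  rewrite add0e; have [ze|ez] := leP (- e)%R z.
    apply: (le_trans (iter_step_reflect_le n d0 uF F0 _ ze)); first by lra.
    by rewrite leeDl// adde_ge0//; exact: rfl0.
  apply: (@le_trans _ _ (rfl (cst 1 \_ A) z)); last first.
    by rewrite addeA leeDr// adde_ge0// (unit_fun_ge0 uI).
  rewrite lee_wpmul2l ?lee_fin ?expR_ge0// patchE mem_set.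
    exact: unit_fun_le1.
  by rewrite /A/= in_itv/= andbT; lra.
rewrite ![iter n.+1 _ _]iterS killed_stepE//.
have -> : (expR (-2 * (x + e)))%:E * step d (iter n (step d) F) (- (2 * e + x))%R
    = rfl (step d (iter n (step d) F)) x.
  by rewrite /rfl opprK; congr (_ * step _ _ _); lra.
rewrite -stepr// -transitionD//; [|exact: (proj1 uK)|exact: mrfl
  |exact: unit_fun_ge0|exact: rfl0].
have mI := proj1 uI; have mK := proj1 uK.
have mC := emeasurable_funD (@measurable_cst _ _ _ _ setT (n%:R * eta)%:E) (mrfl _ uA).
apply: (@le_trans _ _ (step d (iter n (step d) F \+
    (cst (n%:R * eta)%:E \+ rfl (cst 1 \_ A))) x)).
  apply: le_transition IH'.
  - exact: emeasurable_funD mK (mrfl _ uI).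
  - exact: emeasurable_funD mI mC.
  - by move=> z; rewrite adde_ge0 ?(unit_fun_ge0 uK) ?rfl0.
have eta0 : (0 <= n%:R * eta)%R by rewrite mulr_ge0// expR_ge0.
have rA0 := rfl0 _ uA; have mrA := mrfl _ uA.
rewrite (transitionD _ _ _ mI mC (unit_fun_ge0 uI)); last first.
  by move=> z; rewrite adde_ge0//= lee_fin.
rewrite leeD2l// transitionD//.
rewrite transition_cst.
rewrite -natr1 mulrDl mul1r EFinD leeD2l// stepr// /rfl.
apply: (@le_trans _ _ (step d (cst 1 \_ A) (2 * - e - x)%R)).
  have u := transition_unit 1 d0 uA.
  rewrite -[leRHS]mul1e lee_wpmul2r ?(unit_fun_ge0 u)// lee_fin -expR0 ler_expR.
  by rewrite mulNr oppr_le0 mulr_ge0//; lra.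
rewrite /transition -integral_mkcond integral_cst// mul1e.
apply: (le_trans (normal_prob_tail (L := L) (x := (- e)%R) _ _ mA _)).
- exact: sqrt_neq0.
- by move=> z; rewrite /A/= in_itv/= andbT => ez; rewrite ler_wpM2l// ltW.
rewrite lee_fin /eta ler_expR sqr_sqrtr; last exact: ltW.
rewrite lerD2r lerN2 ler_wpM2l//; lra.
Qed.

Lemma limn_einf_le (u : (\bar R)^nat) r : (forall n, u n <= r) -> limn_einf u <= r.
Proof.
move=> ur; rewrite limn_einf_lim; apply: lime_le; first exact: is_cvg_einfs.
apply: nearW => n; apply: le_trans (ur n); apply: ereal_inf_lbound.
by exists n => /=.
Qed.

Lemma normal_pdfC m (s : R) z : s != 0%R -> normal_pdf m s z = normal_pdf z s m.
Proof.
move=> s0; rewrite !normal_pdfE// /normal_fun.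
by rewrite -(sqrrN (z - m)%R) opprB.
Qed.

(** This lets the level of reflection [- r] rise to [0]. As [F] need not be
continuous, the lemma relies on the continuity of the density in its mean and
on Fatou's lemma, which gives the one inequality that is used. *)
Lemma transition_reflect_cvg h F x e : (0 < h)%R -> unit_fun F -> (0 < e)%R ->
  exists2 r : R, (0 < r)%R & step h F (- x)%R <=
    (expR (- 2 * r))%:E * step h F (- (2 * r + x))%R + e%:E.
Proof.
move=> h0 uF e0; apply: contrapT => /forall2NP H.
have mF := proj1 uF; have F0 := unit_fun_ge0 uF.
pose r : nat -> R := harmonic; have cr : r @ \oo --> (0 : R)%R := cvg_harmonic.
have r0 n : (0 < r n)%R by rewrite /r/= invr_gt0.
pose m q : R := (- (2 * q + x) + 1 * h)%R.
pose g n z := (expR (- 2 * r n))%:E * (F z * (normal_pdf (m (r n)) (Num.sqrt h) z)%:E).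
have mpdf m' : measurable_fun setT (EFin \o normal_pdf m' (Num.sqrt h)).
  by apply/measurable_EFinP; exact: measurable_normal_pdf.
have mg n : measurable_fun [set: R] (g n).
  apply: emeasurable_funM; first exact: measurable_cst.
  exact: emeasurable_funM mF (mpdf _).
have g0 n z : 0 <= g n z by rewrite mule_ge0 ?lee_fin ?expR_ge0 ?ge0_mul_pdf.
have cg z : g ^~ z @ \oo --> F z * (normal_pdf (- x + 1 * h) (Num.sqrt h) z)%:E.
  rewrite -(fineK (unit_fun_fin_num uF z)) -EFinM.
  pose phi q := (expR (- 2 * q) *
    (fine (F z) * normal_pdf z (Num.sqrt h) (m q)))%R.
  have -> : g ^~ z = EFin \o (phi \o r).
    apply/funext => n; rewrite /g /= -(fineK (unit_fun_fin_num uF z)) -!EFinM.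
    by rewrite normal_pdfC ?sqrt_neq0.
  rewrite normal_pdfC ?sqrt_neq0//.
  have -> : (fine (F z) * normal_pdf z (Num.sqrt h) (- x + 1 * h))%R = phi 0%R.
    rewrite /phi (_ : m 0%R = - x + 1 * h)%R; last by rewrite /m; lra.
    by rewrite mulr0 expR0 [RHS]mul1r.
  apply: cvg_EFin; first exact: nearW.
  have cphi : {for 0%R, continuous phi}.
    have ce : {for 0%R, continuous (@expR R \o ( *%R (- 2)%R))}.
      apply: continuous_comp; first exact: mulrl_continuous.
      exact: continuous_expR.
    have cm : {for 0%R, continuous m}.
      apply: (@cvgD _ R^o); last exact: cvg_cst.
      apply: (@cvgN _ R^o); apply: (@cvgD _ R^o); last exact: cvg_cst.
      exact: mulrl_continuous.
    have cpm : {for 0%R, continuous (normal_pdf z (Num.sqrt h) \o m)}.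
      by apply: continuous_comp => //; exact/continuous_normal_pdf/sqrt_neq0.
    by apply: cvgM ce _; apply: cvgM cpm; exact: cvg_cst.
  exact: (cvg_comp _ _ cr cphi).
have := @fatou _ _ _ lebesgue_measure setT measurableT g mg (fun n z _ => g0 n z).
under eq_integral => z _ do rewrite (cvg_limn_einf_sup (cg z)).1.
rewrite -(ge0_transitionE _ _ _ mF F0); apply/negP; rewrite -ltNge.
have uK := transition_unit 1 h0 uF.
have Kf := unit_fun_fin_num uK (- x)%R.
apply: (@le_lt_trans _ _ (step h F (- x)%R - e%:E)); last first.
  by rewrite lteBlDr// lteDl// ?lte_fin.
apply: limn_einf_le => n.
rewrite (ge0_integralZ_pdf _ _ _ mF F0) -(ge0_transitionE _ _ _ mF F0).
have [//|/negP] := H (r n); rewrite -ltNge => /ltW.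
by move=> ?; rewrite leeBrDr.
Qed.

(** The method of images for the level [0]: the limit, for fine grids, of the
walk killed at the grid points below [0]. *)
Definition killed h F x : \bar R := if (0 <= x)%R
  then step h F x - (expR (- 2 * x))%:E * step h F (- x)%R else 0.

(** With [n ^ 2] steps, the Chernoff parameter [L = n] keeps [L ^ 2] times the
length of a step bounded, while [exp (- L e)] outweighs the number of steps. *)
Definition grid_size p := (p.+1 ^ 2)%N.

Definition grid_step h p : R := (h / (grid_size p)%:R)%R.

Lemma grid_size_gt0 p : (0 < grid_size p)%N.
Proof. by rewrite expn_gt0. Qed.

Lemma grid_step_gt0 h p : (0 < h)%R -> (0 < grid_step h p)%R.
Proof. by move=> h0; rewrite divr_gt0// ltr0n grid_size_gt0. Qed.

Lemma grid_sizeM h p : ((grid_size p)%:R * grid_step h p = h)%R.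
Proof. by rewrite /grid_step mulrCA divff ?mulr1// pnatr_eq0 -lt0n grid_size_gt0. Qed.

Lemma grid_error_cvg0 h e : (0 < h)%R -> (0 < e)%R ->
  ((grid_size p)%:R * expR (- (p.+1%:R * (e - grid_step h p)) +
     p.+1%:R ^+ 2 * grid_step h p / 2))%R @[p --> \oo] --> (0 : R)%R.
Proof.
move=> h0 e0; pose C := (6 * expR (2 * h) / e ^+ 3)%R.
apply: (@squeeze_cvgr _ _ _ _ (cst 0%R) (fun p => C * harmonic p)%R).
- apply: nearW => p; rewrite mulr_ge0 ?expR_ge0//=.
  have p0 : (0 < p.+1%:R :> R)%R by [].
  set P : R := p.+1%:R in p0 *.
  have -> : (grid_size p)%:R = (P ^+ 2)%R :> R by rewrite natrX.
  have dE : (P ^+ 2 * grid_step h p = h)%R.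
    by rewrite -[RHS](grid_sizeM h p) natrX.
  have d0 := grid_step_gt0 p h0; set d := grid_step h p in dE d0 *.
  have Pd : (P * d <= h)%R.
    have P1 : (1 <= P)%R by rewrite /P ler1n.
    have Pd0 : (0 <= P * d)%R by rewrite mulr_ge0// ltW.
    by rewrite -dE expr2 -mulrA ler_peMl.
  have H : (expR (- (P * (e - d)) + P ^+ 2 * d / 2) <=
      expR (2 * h) * expR (- (P * e)))%R.
    by rewrite -expRD ler_expR dE mulrBr; lra.
  apply: (le_trans (ler_wpM2l _ H)); first by rewrite sqr_ge0.
  have Pe : (0 < P * e)%R by rewrite mulr_gt0.
  (* The cubic term of the exponential series beats the [P ^ 2] steps. *)
  have X3 : (expR (- (P * e)) <= ((P * e) ^+ 3 / 6)^-1)%R.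
    rewrite expRN lef_pV2 ?posrE ?expR_gt0 ?divr_gt0 ?exprn_gt0//.
    apply: le_trans (@expR_ge1Dxn R (P * e)%R 2 (ltW Pe)).
    by rewrite lerDr.
  apply: (@le_trans _ _ (P ^+ 2 * (expR (2 * h) * ((P * e) ^+ 3 / 6)^-1))%R).
    by rewrite ler_wpM2l ?sqr_ge0// ler_wpM2l ?expR_ge0.
  by rewrite le_eqVlt; apply/orP; left; apply/eqP; rewrite /C; field; rewrite !gt_eqF.
- exact: cvg_cst.
- rewrite -[X in _ --> X](mulr0 C); apply: cvgM; [exact: cvg_cst|exact: cvg_harmonic].
Qed.

(** The walk killed at grid points lies between the two reflection bounds: the
lower one is exact, and the upper one becomes so as its level rises to [0]. *)
Lemma iter_killed_cvg h F x : (0 < h)%R -> unit_fun F ->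
  (forall z, (z < 0)%R -> F z = 0) ->
  iter (grid_size p) (killed_step (grid_step h p)) F x @[p --> \oo] -->
    killed h F x.
Proof.
move=> h0 uF F0; rewrite /killed; have [x0|x0] := leP 0%R x; last first.
  under eq_fun => p.
    rewrite -(prednK (grid_size_gt0 p)) iterS (killed_step0 _ _ x0); over.
  exact: cvg_cst.
have d0 p := grid_step_gt0 p h0.
have uK := transition_unit 1 h0 uF.
have itE p : iter (grid_size p) (step (grid_step h p)) F = step h F.
  have nE := prednK (grid_size_gt0 p).
  by rewrite -nE (iter_step _ (d0 p) uF) nE (grid_sizeM h p).
have uU p := unit_fun_iter_killed (grid_size p) (d0 p) uF.
pose u p := fine (iter (grid_size p) (killed_step (grid_step h p)) F x).
pose K y := fine (step h F y).
have uE p : iter (grid_size p) (killed_step (grid_step h p)) F x = (u p)%:E.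
  by rewrite /u fineK//; exact: unit_fun_fin_num.
have KE y : step h F y = (K y)%:E by rewrite /K fineK//; exact: unit_fun_fin_num.
under eq_fun do rewrite uE.
rewrite !KE -EFinM -EFinB; apply: cvg_EFin; first exact: nearW.
apply/(@cvgrPdist_le _ R^o) => e e0; have e20 : (0 < e / 2)%R by lra.
(* [a], [b]: the values at [x] and, weighted, at its mirror point; [v]: the
   killed value; [f], [g]: the value at the mirror point for the level [- r] and
   the gap to [b]; [t]: the error from jumps. *)
have arith (a b f g v t c : R) : (0 < c)%R -> (t <= c / 2)%R ->
    (a <= v + b)%R -> (v + f <= a + t)%R -> (b <= f + g)%R ->
    (g <= c / 2)%R -> (- c <= a - b - v <= c)%R.
  by move=> *; apply/andP; split; lra.
have [r r0] := transition_reflect_cvg x h0 uF e20.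
rewrite !KE -EFinM -EFinD lee_fin => Hr.
near=> p.
have := iter_killed_ge (grid_size p) x (d0 p) uF F0.
rewrite itE uE !KE -EFinM -EFinD lee_fin => Hge.
have P0 : (0 <= p.+1%:R :> R)%R by [].
have := iter_killed_le (grid_size p) (d0 p) r0 P0 uF F0 x0.
rewrite itE uE !KE -EFinM -!EFinD lee_fin mulrDr expRD => Hle.
have eta_le : ((grid_size p)%:R * expR (- (p.+1%:R * (r - grid_step h p)) +
     p.+1%:R ^+ 2 * grid_step h p / 2) <= e / 2)%R.
  near: p; move/(@cvgrPdist_le _ R^o) : (grid_error_cvg0 h0 r0) => /(_ _ e20).
  apply: filterS => p; rewrite sub0r normrN; apply: le_trans; exact: ler_norm.
have E1 : (expR (- 2 * x) <= 1)%R.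
  by rewrite -expR0 ler_expR mulNr oppr_le0 mulr_ge0.
have E0 := expR_ge0 (- 2 * x)%R.
move: eta_le Hle; set eta := (_ * expR (_ + _))%R => eta_le Hle.
change (`|K x - expR (-2 * x) * K (- x) - u p| <= e)%R.
have H1 : (expR (-2 * x) * K (- x) <=
    expR (-2 * x) * (expR (-2 * r) * K (- (2 * r + x)) + e / 2))%R.
  exact: ler_wpM2l.
have H2 : (expR (-2 * x) * (e / 2) <= e / 2)%R by rewrite ler_piMl// ltW.
rewrite mulrDr mulrA in H1; rewrite ler_norml.
exact: (arith _ _ _ _ _ _ _ e0 eta_le Hge Hle H1 H2).
Unshelve. all: by end_near. Qed.

End killed_walk.

(** * The reflection identity along a finite schedule *)

Section schedule.
Context {R : realType}.
Implicit Types (h x y z : R) (F : R -> \bar R) (B : set R)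
  (l : seq (R * set R)).
Local Open Scope ereal_scope.
Local Notation step d := (transition 1 d).

(** The part of [transition 1 h F] carried by the paths that visit the
negatives, provided that [F] vanishes there. *)
Definition visiting h F x : \bar R := if (0 <= x)%R
  then (expR (- 2 * x))%:E * step h F (- x)%R else step h F x.

Lemma killed_visiting h F x : (0 < h)%R -> unit_fun F ->
  killed h F x + visiting h F x = step h F x.
Proof.
move=> h0 uF; have uK := transition_unit 1 h0 uF.
rewrite /killed /visiting; case: ifP => _; last by rewrite add0e.
rewrite subeK// fin_numM//; exact: unit_fun_fin_num.
Qed.

Lemma killed0 h F x : (x < 0)%R -> killed h F x = 0.
Proof. by rewrite /killed leNgt => ->. Qed.

Lemma killed_at0 h F : (0 < h)%R -> unit_fun F -> killed h F 0%R = 0.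
Proof.
move=> h0 uF; have uK := transition_unit 1 h0 uF.
rewrite /killed lexx mulr0 expR0 mul1e oppr0 subee//; exact: unit_fun_fin_num.
Qed.

Lemma unit_fun_killed h F : (0 < h)%R -> unit_fun F ->
  (forall z, (z < 0)%R -> F z = 0) -> unit_fun (killed h F).
Proof.
move=> h0 uF F0; have cK x := @iter_killed_cvg _ h F x h0 uF F0.
have uU p := unit_fun_iter_killed (grid_size p) (grid_step_gt0 p h0) uF.
split=> [|x].
  apply: (emeasurable_fun_cvg (fun p => iter (grid_size p)
    (killed_step (grid_step h p)) F)) => //.
  by move=> p; exact: (proj1 (uU p)).
have <- := cvg_lim (@ereal_hausdorff R) (cK x).
have cv : cvgn (fun p => iter (grid_size p) (killed_step (grid_step h p)) F x).
  by apply/cvg_ex; exists (killed h F x).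
apply/andP; split; [apply: lime_ge|apply: lime_le] => //.
  by apply: nearW => p; exact: unit_fun_ge0.
by apply: nearW => p; exact: unit_fun_le1.
Qed.

Lemma visiting_ge0 h F x : unit_fun F -> 0 <= visiting h F x.
Proof.
move=> uF; rewrite /visiting; case: ifP => _.
  rewrite mule_ge0 ?lee_fin ?expR_ge0//.
  by apply: transition_ge0; exact: unit_fun_ge0.
by apply: transition_ge0; exact: unit_fun_ge0.
Qed.

Lemma measurable_visiting h F : (0 < h)%R -> unit_fun F ->
  measurable_fun [set: R] (visiting h F).
Proof.
move=> h0 uF; have mK := proj1 (transition_unit 1 h0 uF).
apply: measurable_fun_ifT => //.
  by apply: measurable_fun_ler.
apply: emeasurable_funM.
  by apply/measurable_EFinP; apply: measurableT_comp (@measurable_expR R) _.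
by apply: measurableT_comp mK _.
Qed.

(** The weight [exp x] makes [visiting h F] even: this is the reflection
principle in the form used below. *)
Lemma visiting_reflect h F x :
  visiting h F x = (expR (- 2 * x))%:E * visiting h F (- x)%R.
Proof.
have [x0|x0|->] := ltrgtP x 0%R.
- rewrite /visiting oppr_ge0 (ltW x0) leNgt x0/= opprK muleA -EFinM -expRD.
  by rewrite -mulrDr subrr mulr0 expR0 mul1e.
- by rewrite /visiting oppr_ge0 (ltW x0) leNgt x0.
- by rewrite oppr0 mulr0 expR0 mul1e.
Qed.

Definition admissible l := forall hB, hB \in l ->
  (0 < hB.1)%R /\ measurable hB.2.

Lemma admissible_cons hB l : admissible (hB :: l) ->
  [/\ (0 < hB.1)%R, measurable hB.2 & admissible l].
Proof.
move=> lP; have [h0 mB] := lP hB (mem_head _ _).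
by split=> // a al; apply: lP; rewrite in_cons al orbT.
Qed.

Lemma admissible_consI h B l : (0 < h)%R -> measurable B -> admissible l ->
  admissible ((h, B) :: l).
Proof. by move=> h0 mB lP a; rewrite in_cons => /orP[/eqP ->|/lP]. Qed.

Lemma admissible_nil : admissible [::].
Proof. by []. Qed.

(** Three probabilities for the sets [B] of a schedule [l] of pairs [(h, B)],
the next observation being made after a time [h]: a path with drift [1] from
[x] that stays nonnegative and whose opposite is in the sets; a path with drift
[1] that visits the negatives, ends nonnegative and is in the sets once it is
reflected after its last negative value; a path with drift [-1] in the sets
that ends nonpositive. *)
Fixpoint opposite l : R -> \bar R := if l is (h, B) :: l'
  then killed h (opposite l' \_ (-%R @^-1` B)) else cst 1 \_ `[0%R, +oo[.

Fixpoint reflected l : R -> \bar R := if l is (h, B) :: l'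
  then visiting h (opposite l' \_ (-%R @^-1` B)) \+ step h (reflected l' \_ B)
  else cst 0.

Fixpoint downward l : R -> \bar R := if l is (h, B) :: l'
  then transition (- 1) h (downward l' \_ B) else cst 1 \_ `]-oo, 0%R].

Lemma measurable_oppr_preimage B : measurable B -> measurable (-%R @^-1` B).
Proof.
move=> mB; rewrite -[X in measurable X]setTI.
by apply: (@oppr_measurable R setT).
Qed.

Lemma opposite0 l z : (z < 0)%R -> opposite l z = 0.
Proof.
case: l => [|[h B] l] z0 /=; last exact: killed0.
by rewrite patchE memNset//= in_itv/= andbT; apply/negP; rewrite -ltNge.
Qed.

Lemma opposite_restrict0 l B z : (z < 0)%R -> (opposite l \_ B) z = 0.
Proof. by move=> z0; rewrite patchE; case: ifP => // _; exact: opposite0. Qed.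

Lemma unit_fun_opposite l : admissible l -> unit_fun (opposite l).
Proof.
elim: l => [_|[h B] l IH /admissible_cons[/= h0 mB /IH uO]].
  by apply: unit_fun_restrict => //; exact: unit_fun1.
apply: unit_fun_killed => //; last exact: opposite_restrict0.
by apply: unit_fun_restrict => //; exact: measurable_oppr_preimage.
Qed.

Lemma unit_fun_opposite_restrict l B : admissible l -> measurable B ->
  unit_fun (opposite l \_ (-%R @^-1` B)).
Proof.
move=> lP mB; apply: unit_fun_restrict; first exact: measurable_oppr_preimage.
exact: unit_fun_opposite.
Qed.

Lemma unit_fun_downward l : admissible l -> unit_fun (downward l).
Proof.
elim: l => [_|[h B] l IH /admissible_cons[/= h0 mB /IH uO]].
  by apply: unit_fun_restrict => //; exact: unit_fun1.
by apply: transition_unit => //; exact: unit_fun_restrict.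
Qed.

Lemma ge0_restrict F B : (forall z, 0 <= F z) -> forall z, 0 <= (F \_ B) z.
Proof. by move=> F0 z; rewrite patchE; case: ifP. Qed.

Lemma reflected_ge0 l : admissible l -> forall x, 0 <= reflected l x.
Proof.
elim: l => [//|[h B] l IH /admissible_cons[/= h0 mB lP]] x.
rewrite adde_ge0//; first by apply: visiting_ge0; exact: unit_fun_opposite_restrict.
by apply: transition_ge0; apply: ge0_restrict; exact: IH.
Qed.

Lemma measurable_reflected l : admissible l ->
  measurable_fun [set: R] (reflected l).
Proof.
elim: l => [_|[h B] l IH /admissible_cons[/= h0 mB lP]]; first exact: measurable_cst.
apply: emeasurable_funD.
  by apply: measurable_visiting => //; exact: unit_fun_opposite_restrict.
apply: measurable_transition => //.
  by apply: measurable_patch => //; exact: IH.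
by apply: ge0_restrict; exact: reflected_ge0.
Qed.

(** At [x = 0], where [opposite] vanishes, this says that the reflected path has
the law of the path with opposite drift. For the other starting points the term
[opposite l (- x)] is what makes the induction on the schedule close: one step
with drift [1], applied to the identity for the rest of the schedule, turns the
weight [exp (-2 z)] into the drift [-1] on the right and into a reflection on
the left. *)
Lemma reflected_opposite l x : admissible l ->
  reflected l x + (expR (- 2 * x))%:E * opposite l (- x)%R =
  (expR (- 2 * x))%:E * downward l x.
Proof.
elim: l x => [x _|[h B] l IH x /admissible_cons[/= h0 mB lP]].
  rewrite /= add0e !patchE; congr (_ * _).
  by rewrite !mem_setE !in_itv/= andbT oppr_ge0.
set N := opposite l \_ _; have uN : unit_fun N by exact: unit_fun_opposite_restrict.
have uO := unit_fun_opposite lP; have uD := unit_fun_downward lP.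
have uDB := unit_fun_restrict mB uD.
have r0 := ge0_restrict B (reflected_ge0 lP).
have mr := measurable_patch mB (measurable_reflected lP).
rewrite visiting_reflect addeAC -ge0_muleDr//; last 2 first.
- exact: visiting_ge0.
- by apply: unit_fun_ge0; apply: unit_fun_killed => // z; exact: opposite_restrict0.
rewrite addeC (addeC (visiting _ _ _)) killed_visiting//.
have e0 z : 0 <= (expR (- 2 * z))%:E * N (- z)%R.
  by rewrite mule_ge0 ?lee_fin ?expR_ge0// unit_fun_ge0.
have ET := transition_tilt x h0 (proj1 uDB) (unit_fun_ge0 uDB).
have ER := transition_reflect0 x h0 (proj1 uN) (unit_fun_ge0 uN).
apply: etrans (congr2 adde (erefl _) (esym ER)) _; apply: etrans _ ET.
apply: etrans (esym (transitionD 1 h x mr (measurable_reflect (proj1 uN)) r0 e0)) _.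
congr (transition _ _ _ _); apply/funext => z /=.
rewrite /N !patchE.
have -> : (- z)%R \in -%R @^-1` B = (z \in B).
  by apply/idP/idP; rewrite !inE/= opprK.
case: ifP => _; last by rewrite !mule0 adde0.
by rewrite IH.
Qed.

(** The empty schedule is excluded because a path observed only at time [0] has
not yet visited the negatives. *)
Lemma reflected_at0 l : admissible l -> l != [::] ->
  opposite l 0%R = 0 /\ reflected l 0%R = downward l 0%R.
Proof.
move=> lP l0; have O0 : opposite l 0%R = 0.
  case: l l0 lP => [//|[h B] l] _ /admissible_cons[/= h0 mB lP].
  by rewrite killed_at0//; exact: unit_fun_opposite_restrict.
split=> //; have := reflected_opposite 0%R lP.
by rewrite oppr0 O0 mulr0 expR0 mule0 mul1e adde0.
Qed.

End schedule.

(** * Sigma-algebras generated by families of real functions *)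

Section generated.
Context {R : realType} {I : choiceType} {T : Type}.
Implicit Types (D : set I) (f : I -> T -> R) (A B : set T).

Definition gen D f : set (set T) :=
  \bigcup_(i in D) preimage_set_system setT (f i) measurable.

Definition box D f : set (set T) := [set A | exists L : seq I,
  exists2 B : I -> set R, (forall i, i \in L -> D i) /\
    (forall i, measurable (B i)) & A = \bigcap_(i in [set` L]) f i @^-1` B i].

(** Different lists of indices are merged by constraining the missing indices
to the whole line. *)
Lemma box_setI_closed D f : setI_closed (box D f).
Proof.
move=> _ _ [L [B [LD mB] ->]] [L' [B' [LD' mB'] ->]].
pose C i := (if i \in L then B i else setT) `&`
  (if i \in L' then B' i else setT).
exists (L ++ L'); exists C; first split.
- by move=> i; rewrite mem_cat => /orP[/LD|/LD'].
- by move=> i; apply: measurableI; case: ifP.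
apply/seteqP; split => [w [H H'] i /=|w H].
  by move=> _; split; case: ifP => // iL; [exact: H|exact: H'].
split=> i /= iL.
  by have := H i; rewrite /= mem_cat iL => /(_ isT)[]; rewrite iL.
by have := H i; rewrite /= mem_cat iL orbT => /(_ isT)[_]; rewrite iL.
Qed.

Lemma sub_gen_box D f : <<s gen D f>> `<=` <<s box D f>>.
Proof.
apply: smallest_sub; first exact: smallest_sigma_algebra.
move=> _ [i Di [B mB <-]]; apply: sub_sigma_algebra.
exists [:: i]; exists (fun=> B); first by split=> // j; rewrite inE => /eqP ->.
rewrite setTI; apply/seteqP; split => [w Bw j|w H]; last exact: (H i (mem_head _ _)).
by rewrite /= inE => /eqP ->.
Qed.

Lemma gen_preimage D f i (B : set R) : D i -> measurable B ->
  <<s gen D f>> (f i @^-1` B).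
Proof.
by move=> Di mB; apply: sub_sigma_algebra; exists i => //; exists B; rewrite ?setTI.
Qed.

Lemma sub_gen D D' f : D `<=` D' -> <<s gen D f>> `<=` <<s gen D' f>>.
Proof.
move=> DD'; apply: smallest_sub; first exact: smallest_sigma_algebra.
by move=> A [i Di Ai]; apply: sub_sigma_algebra; exists i => //; exact: DD'.
Qed.

End generated.

Lemma gen_measurable {R : realType} {I : choiceType} d (T : measurableType d)
    (D : set I) (f : I -> T -> R) :
  (forall i, D i -> measurable_fun setT (f i)) -> <<s gen D f>> `<=` measurable.
Proof.
move=> mf; apply: smallest_sub; first exact: sigma_algebra_measurable.
by move=> _ [i Di [B mB <-]]; exact: mf.
Qed.

(** Finite boxes form a pi-system that generates the sigma-algebra. *)
Lemma gen_measure_unique {R : realType} {I : choiceType} d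
    (T : measurableType d) (D : set I) (f : I -> T -> R)
    (m1 m2 : {measure set T -> \bar R}) :
  (forall i, D i -> measurable_fun setT (f i)) ->
  (m1 setT < +oo)%E -> (forall A, box D f A -> m1 A = m2 A) ->
  forall A, <<s gen D f>> A -> m1 A = m2 A.
Proof.
move=> mf m1oo m12 A /sub_gen_box; apply: (g_sigma_algebra_measure_unique
    (box D f) _ (fun=> setT)) => //.
- move=> _ [L [B [LD mB] ->]]; apply: fin_bigcap_measurable => [|i iL].
    exact: finite_seq.
  by rewrite -[X in measurable X]setTI; apply: mf => //; exact: LD.
- move=> _; exists [::]; exists (fun=> setT); first by split.
  by apply/seteqP; split.
- by apply/seteqP; split => // w _; exists 0%N.
- exact: box_setI_closed.
Qed.

(** * Brownian motion with drift *)

Section brownian.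
Context {R : realType} {d} {Om : measurableType d} {P : probability Om R}.
Variables (b : R) (X : R -> {RV P >-> R}).
Hypothesis hX : brownian_motion_with_drift b X.

Definition past s : set (set Om) :=
  <<s gen [set u | 0 <= u <= s] (fun u => X u : Om -> R)>>.

Local Notation past_type s :=
  (g_sigma_algebraType (gen [set u | 0 <= u <= s] (fun u => X u : Om -> R))).

Lemma past_measurable s A : past s A -> measurable A.
Proof. by apply: gen_measurable => i _; exact: measurable_funPT. Qed.

Lemma past_le s t A : s <= t -> past s A -> past t A.
Proof.
move=> st; apply: sub_gen => u /andP[u0 us]; rewrite /= u0/=.
exact: le_trans st.
Qed.

Lemma past_preimage s u (B : set R) : 0 <= u <= s -> measurable B ->
  past s (X u @^-1` B).
Proof. by move=> us mB; exact: (gen_preimage (f := fun u => X u : Om -> R)). Qed.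

Lemma pastI s A B : past s A -> past s B -> past s (A `&` B).
Proof.
exact: (@measurableI _ (past_type s)).
Qed.

Lemma pastC s A : past s A -> past s (~` A).
Proof.
exact: (@measurableC _ (past_type s)).
Qed.

Lemma pastT s : past s setT.
Proof.
exact: (@measurableT _ (past_type s)).
Qed.

Lemma past_bigcap s (F : nat -> set Om) (D : set nat) :
  (forall i, D i -> past s (F i)) -> past s (\bigcap_(i in D) F i).
Proof.
have [->|/set0P D0] := eqVneq D set0; first by rewrite bigcap_set0 => _; exact: pastT.
exact: (@bigcap_measurable _ (past_type s)).
Qed.

Lemma measurable_increment s t : measurable_fun setT (increment X s t).
Proof. by apply: measurable_funB; exact: measurable_funPT. Qed.

Lemma measurable_preimageX u (B : set R) : measurable B -> measurable (X u @^-1` B).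
Proof. by move=> mB; rewrite -[X in measurable X]setTI; exact: measurable_funPT. Qed.

Lemma measurable_preimage_increment s t (B : set R) : measurable B ->
  measurable (increment X s t @^-1` B).
Proof. by move=> mB; rewrite -[X in measurable X]setTI; exact: measurable_increment. Qed.

Lemma increments_indep (t : nat -> R) n A (B : set R) :
  0 <= t 0%N -> {homo t : i j / (i <= j)%N >-> i <= j} -> measurable B ->
  <<s gen `I_n (fun i => increment X (t i) (t i.+1))>> A ->
  P (A `&` increment X (t n) (t n.+1) @^-1` B) =
    (P A * P (increment X (t n) (t n.+1) @^-1` B))%E.
Proof.
move=> t0 tm mB; have [_ iX _ _] := hX.
set E := increment X (t n) (t n.+1) @^-1` B.
have mE : measurable E by exact: measurable_preimage_increment.
have PE0 : (0 <= fine (P E))%R by rewrite fine_ge0.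
pose m1 := mrestr P mE; pose m2 := mscale (NngNum PE0) P.
have m2E C : m2 C = (P C * P E)%E.
  by rewrite /m2/= /mscale/= fineK ?fin_num_measure// muleC.
rewrite -m2E -/(mrestr P mE A); apply: (gen_measure_unique (m1 := m1) (m2 := m2)).
- by move=> i _; exact: measurable_increment.
- by rewrite /m1 /= /mrestr setTI (le_lt_trans (probability_le1 _ mE)) ?ltry.
move=> _ [L [B0 [LD mB0] ->]].
pose B' i := if i == n then B else if i \in L then B0 i else setT.
have mB' i : measurable (B' i) by rewrite /B'; do 2 case: ifP => //.
have capE : \bigcap_(i in [set` L]) (increment X (t i) (t i.+1) @^-1` B0 i) =
    \bigcap_(i in `I_n) (increment X (t i) (t i.+1) @^-1` B' i).
  apply/seteqP; split => w H i /= iL.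
    rewrite /B' lt_eqF//; case: ifP => // iL'; exact: H.
  have iN := LD _ iL; have := H i iN; rewrite /B' /= lt_eqF// iL; exact.
apply: etrans _ (esym (m2E _)); rewrite /m1/= /mrestr capE iX//.
have -> : \bigcap_(i in `I_n) (increment X (t i) (t i.+1) @^-1` B' i) `&` E =
    \bigcap_(i in `I_n.+1) (increment X (t i) (t i.+1) @^-1` B' i).
  apply/seteqP; split => [w [H Ew] i /=|w H].
    rewrite ltnS leq_eqVlt => /orP[/eqP ->|/H//].
    by rewrite /B' eqxx.
  split=> [i /= iN|]; first exact/H/ltnW.
  by have := H n (ltnSn n); rewrite /B' /= eqxx.
rewrite iX// big_ord_recr/=; congr (_ * P (_ @^-1` _))%E.
by rewrite /B' eqxx.
Qed.

(** It suffices to consider a finite box of the past; its values are sums of the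
increments between the sorted times of the box, and these are independent of
the next increment. *)
Lemma past_indep s t A (B : set R) : 0 <= s -> s < t -> past s A -> measurable B ->
  P (A `&` increment X s t @^-1` B) =
    (P A * normal_prob (b * (t - s)) (Num.sqrt (t - s)) B)%E.
Proof.
move=> s0 st sA mB; have [X0 _ nX _] := hX; rewrite -nX//.
set E := increment X s t @^-1` B.
have mE : measurable E by exact: measurable_preimage_increment.
have PE0 : (0 <= fine (P E))%R by rewrite fine_ge0.
pose m1 := mrestr P mE; pose m2 := mscale (NngNum PE0) P.
have m2E C : m2 C = (P C * P E)%E.
  by rewrite /m2/= /mscale/= fineK ?fin_num_measure// muleC.
rewrite -m2E -/(mrestr P mE A).
move: A sA; apply: (gen_measure_unique (m1 := m1) (m2 := m2)).
- by move=> u _; exact: measurable_funPT.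
- by rewrite /m1 /= /mrestr setTI (le_lt_trans (probability_le1 _ mE)) ?ltry.
move=> _ [L [B0 [LD mB0] ->]]; apply: etrans _ (esym (m2E _)); rewrite /m1/= /mrestr.
(* [s] is the last entry of the list, and the default value [t] makes the next
   time equal to [t]. *)
pose c := sort <=%R (0 :: s :: L); pose T i := nth t c i.
have sc : sorted <=%R c by exact: sort_le_sorted.
have memc u : u \in c = (u \in 0 :: s :: L) by rewrite mem_sort.
have c0s u : u \in c -> 0 <= u <= s.
  rewrite memc !inE => /or3P[/eqP ->|/eqP ->|/LD//]; first by rewrite lexx.
  by rewrite s0 lexx.
have szc : size c = (size L).+2 by rewrite size_sort.
have Tm : {homo T : i j / (i <= j)%N >-> i <= j}.
  move=> i j ij; have [jc|cj] := ltnP j (size c).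
    apply: (sorted_leq_nth le_trans le_refl t sc) => //.
    by rewrite inE (leq_ltn_trans ij).
  rewrite /T [leRHS]nth_default//; have [ic|ci] := ltnP i (size c).
    by have /c0s/andP[_ /le_trans] := mem_nth t ic; apply; exact: ltW.
  by rewrite nth_default.
have T0 : T 0%N = 0.
  apply/le_anti; have c0 : 0 \in c by rewrite memc mem_head.
  have := nth_index t c0; rewrite -/(T _) => T0.
  rewrite -[X in _ <= X <= _]T0 Tm//= T0.
  by have /c0s/andP[] : T 0%N \in c by apply: mem_nth; rewrite szc.
have Tn : T (size L).+1 = s.
  apply/le_anti; have cs : s \in c by rewrite memc !inE eqxx orbT.
  have := nth_index t cs; rewrite -/(T _) => Ts.
  have /c0s/andP[_ ->]/= : T (size L).+1 \in c by apply: mem_nth; rewrite szc.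
  by rewrite -[leLHS]Ts Tm// -ltnS -szc index_mem.
have Tn1 : T (size L).+2 = t by rewrite /T nth_default// szc.
have := @increments_indep T (size L).+1 _ B; rewrite Tn Tn1; apply => //.
  by rewrite T0.
set G := gen _ _.
have mX u : u \in c -> @measurable_fun _ _ (g_sigma_algebraType G) _ setT (X u).
  move=> uc; have -> : (X u : Om -> R) =
      (fun w => \sum_(i <- index_iota 0 (index u c)) increment X (T i) (T i.+1) w).
    apply/funext => w; rewrite telescope_sumr// T0 X0 subr0 /T nth_index//.
  have uL : (index u c <= (size L).+1)%N by rewrite -ltnS -szc index_mem.
  under eq_fun do rewrite big_mkord.
  apply: (@measurable_sum _ (g_sigma_algebraType G)) => i _ C mC; rewrite setTI.
  apply: (gen_preimage (f := fun i => increment X (T i) (T i.+1))) => //=.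
  exact: leq_trans uL.
apply: (@fin_bigcap_measurable _ (g_sigma_algebraType G)) => [|u /= uL].
  exact: finite_seq.
have uc : u \in c by rewrite memc !inE uL !orbT.
by have := mX u uc measurableT _ (mB0 u); rewrite setTI.
Qed.

(** The Markov property, for a random element [Y] of the past: by independence,
the pair of [Y] and the next increment has a product law. *)
Lemma past_fubini d' (T : measurableType d') (Y : {mfun Om >-> T}) (s t : R)
    (g : T * R -> \bar R) :
  0 <= s -> s < t -> (forall C, measurable C -> past s (Y @^-1` C)) ->
  measurable_fun setT g -> (forall z, (0 <= g z)%E) ->
  (\int[P]_w g (Y w, increment X s t w) =
   \int[P]_w \int[normal_prob (b * (t - s)) (Num.sqrt (t - s))]_z
     g (Y w, z))%E.
Proof.
move=> s0 st sY mg g0.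
set N := normal_prob _ _.
pose J w : T * measurableTypeR R := (Y w, increment X s t w).
have mJ : measurable_fun setT J.
  apply: measurable_fun_pair; first exact: measurable_funPT.
  exact: measurable_increment.
transitivity (\int[pushforward P J]_z g z)%E; first by rewrite ge0_integral_pushforward.
transitivity (\int[(distribution P Y \x N)%E]_z g z)%E; last first.
  rewrite (fubini_tonelli1 (m1 := distribution P Y) (m2 := N))//.
  rewrite ge0_integral_distribution//.
    exact: measurable_fun_fubini_tonelli_F.
  by move=> y; exact: integral_ge0.
apply: eq_measure_integral => A mA _; apply/esym.
apply: product_measure_unique => // C B mC mB.
exact: (past_indep s0 st (sY _ mC) mB).
Qed.

(** The random element to use is the pair of the indicator of [A] and of
[X s]. *)
Lemma past_transition (s t : R) A (F : R -> \bar R) : 0 <= s -> s < t -> past s A ->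
  measurable_fun [set: R] F -> (forall z, (0 <= F z)%E) ->
  (\int[P]_(w in A) F (X t w) =
   \int[P]_(w in A) transition b (t - s) F (X s w))%E.
Proof.
move=> s0 st sA mF F0.
have mA := past_measurable sA.
have mXs : measurable_fun setT (X s) by exact: measurable_funPT.
pose Y w : R * R := (\1_A w, X s w).
have mY : measurable_fun setT Y by exact: measurable_fun_pair.
pose Y' : {mfun Om >-> (R * R)%type} := HB.pack Y (isMeasurableFun.Build _ _ _ _ Y mY).
have mg : measurable_fun setT (fun z : (R * R) * R =>
    `|z.1.1|%:E * F (z.1.2 + z.2)%R)%E.
  apply: emeasurable_funM.
    apply/measurable_EFinP; apply: measurableT_comp => //.
    exact: (measurableT_comp measurable_fst measurable_fst).
  apply: measurableT_comp mF _; apply: measurable_funD => //.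
  exact: (measurableT_comp measurable_snd measurable_fst).
have sY C : measurable C -> past s (Y' @^-1` C).
  have mY' : @measurable_fun _ _ (past_type s) (R * R)%type setT Y.
    apply: measurable_fun_pair; first exact: measurable_indic.
    move=> _ B mB; rewrite setTI; apply: past_preimage => //.
    by rewrite s0 lexx.
  by move=> mC; have := mY' measurableT C mC; rewrite setTI.
have g0 (z : (R * R) * R) : (0 <= `|z.1.1|%:E * F (z.1.2 + z.2)%R)%E.
  by rewrite mule_ge0// lee_fin.
have E := past_fubini s0 st sY mg g0.
have h0 : (0 < t - s) by rewrite subr_gt0.
rewrite integral_mkcond [RHS]integral_mkcond.
transitivity (\int[P]_w (`|\1_A w|%:E * F (X s w + increment X s t w)%R))%E.
  apply: eq_integral => w _; rewrite epatch_indic/= ger0_norm//.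
  by rewrite muleC /increment subrKC.
apply: (etrans E); apply: eq_integral => w _.
rewrite epatch_indic [RHS]muleC (transition_incr _ _ h0 mF F0).
rewrite -[RHS]ge0_integralZl//.
- by apply: eq_integral => z _; rewrite /= ger0_norm.
- by apply: measurableT_comp mF _; exact: measurable_funD.
- by rewrite lee_fin.
Qed.

End brownian.

(** * Staying nonnegative in continuous time *)

(** Bounded convergence. *)
Lemma cvg_integral_unit {R : realType} d (T : measurableType d)
    (P : probability T R) (A : set T) (f_ : nat -> T -> \bar R)
    (f : T -> \bar R) :
  measurable A -> (forall n, measurable_fun setT (f_ n)) ->
  (forall n x, 0 <= f_ n x <= 1)%E ->
  (forall x, f_ ^~ x @ \oo --> f x) ->
  (\int[P]_(x in A) f_ n x @[n --> \oo] --> \int[P]_(x in A) f x)%E.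
Proof.
move=> mA mf f01 cf.
have mfl : measurable_fun setT f.
  exact: (emeasurable_fun_cvg f_).
have [] := @dominated_convergence _ _ _ P A mA f_ f (cst 1%E) _ _ _ _ _ => //.
- by move=> n; exact: measurable_funTS.
- exact: measurable_funTS.
- by apply: aeW => x _; exact: cf.
- by apply: finite_measure_integrable_cst.
apply: aeW => x n _; have /andP[f0 f1] := f01 n x.
by rewrite gee0_abs.
Qed.

Section paths.
Context {R : realType} {T : Type}.
Implicit Types (X : R -> T -> R) (s t u h e : R) (w : T).

Definition nonneg X s t : set T :=
  [set w | forall u, s <= u <= t -> 0 <= X u w].

Definition grid X s e n : set T :=
  \bigcap_(i in `I_n) [set w | 0 <= X (s + i%:R * e) w].

Lemma gridS X s e n :
  grid X s e n.+1 = [set w | 0 <= X s w] `&` grid X (s + e) e n.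
Proof.
have iE i : s + i.+1%:R * e = s + e + i%:R * e.
  by rewrite -natr1 mulrDl mul1r (addrC _ e) addrA.
apply/seteqP; split => [w H|w [H0 H] [|i] /= iN].
- split; first by have := H 0%N isT; rewrite /= mul0r addr0.
  by move=> i /= iN; have := H i.+1 iN; rewrite /= iE.
- by rewrite mul0r addr0.
- by rewrite iE; exact: H.
Qed.

Definition continuous_path X w :=
  {within `[0, +oo[%classic, continuous (fun t => X t w)}.

Lemma continuous_pathP X w : continuous_path X w <->
  forall x, 0 <= x -> forall e, 0 < e -> exists2 r : R, 0 < r &
    forall v, 0 <= v -> `|x - v| < r -> `|X x w - X v w| < e.
Proof.
split=> [/(@subspace_continuousP _ _ _ _) cX x x0 e e0|H].
  have := cX x; rewrite /= in_itv/= x0 => /(_ isT) /(@cvgrPdist_lt _ R^o).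
  move=> /(_ _ e0); rewrite near_withinE => /nbhs_ballP[r /= r0 Hr].
  exists r => // v v0 xv; apply: (Hr v xv).
  by rewrite /= in_itv/= v0.
apply/(@subspace_continuousP _ _ _ _) => x; rewrite /= in_itv/= andbT => x0.
apply/(@cvgrPdist_lt _ R^o) => e e0; have [r r0 Hr] := H x x0 e e0.
rewrite near_withinE; apply/nbhs_ballP; exists r => // v xv.
by rewrite /= in_itv/= andbT => v0; exact: Hr.
Qed.

Lemma negative_near X w u : continuous_path X w -> 0 <= u -> X u w < 0 ->
  exists2 e : R, 0 < e & forall v, 0 <= v -> `|u - v| < e -> X v w < 0.
Proof.
move=> /continuous_pathP cX u0 Xu; have Xu0 : 0 < - X u w by rewrite oppr_gt0.
have [e e0 He] := cX u u0 _ Xu0; exists e => // v v0 /(He _ v0).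
by rewrite ltr_norml => /andP[+ _]; rewrite opprK ltrBrDr -ltrBrDl subrr.
Qed.

Lemma grid_step_near h e : 0 < h -> 0 < e ->
  \forall p \near \oo, grid_step h p < e.
Proof.
move=> h0 e0; have he : 0 < e / h by rewrite divr_gt0.
near=> p; have : p.+1%:R^-1 < e / h.
  by near: p; exact: (near_infty_natSinv_lt (PosNum he)).
rewrite ltr_pdivlMr// mulrC; apply: le_lt_trans.
apply: ler_wpM2l; first exact: ltW.
rewrite lef_pV2 ?posrE ?ltr0n ?grid_size_gt0//.
by rewrite ler_nat /grid_size; rewrite -[leqLHS]expn1 leq_pexp2l.
Unshelve. all: by end_near. Qed.

Lemma grid_detects X w s h u : continuous_path X w -> 0 <= s -> 0 < h ->
  s <= u < s + h -> X u w < 0 ->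
  \forall p \near \oo, ~ grid X s (grid_step h p) (grid_size p) w.
Proof.
move=> cX s0 h0 /andP[su uh] Xu.
have u0 : 0 <= u by exact: le_trans su.
have [e e0 He] := negative_near cX u0 Xu.
near=> p => H; have d0 := grid_step_gt0 p h0.
have de : grid_step h p < e by near: p; exact: grid_step_near.
pose i := Num.truncn ((u - s) / grid_step h p).
have /andP[] : i%:R <= (u - s) / grid_step h p < i.+1%:R.
  apply: truncn_itv; rewrite divr_ge0// ?subr_ge0//; exact: ltW.
rewrite ler_pdivlMr// ltr_pdivrMr// -natr1 mulrDl mul1r => iu ui.
have iN : (i < grid_size p)%N.
  rewrite -(ltr_nat R) -(ltr_pM2r d0) grid_sizeM.
  by apply: (le_lt_trans iu); rewrite ltrBlDl.
have := H i iN; apply/negP; rewrite -ltNge; apply: He.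
  by rewrite addr_ge0// mulr_ge0// ltW.
rewrite ger0_norm; last by lra.
by apply: lt_trans de; lra.
Unshelve. all: by end_near. Qed.

Lemma nonneg_grid X w s h p : 0 < h -> nonneg X s (s + h) w ->
  grid X s (grid_step h p) (grid_size p) w.
Proof.
move=> h0 H i /= iN; apply: H; have d0 := grid_step_gt0 p h0.
rewrite lerDl mulr_ge0 ?(ltW d0)//= lerD2l -[leRHS](grid_sizeM h p).
by rewrite ler_pM2r// ler_nat ltnW.
Qed.

Lemma nonnegE X s h : (forall w, continuous_path X w) -> 0 <= s -> 0 < h ->
  nonneg X s (s + h) = [set w | 0 <= X (s + h) w] `&`
    \bigcap_p grid X s (grid_step h p) (grid_size p).
Proof.
move=> cX s0 h0; apply/seteqP; split => [w H|w [H0 H] u].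
  split; first by apply: H; rewrite lexx lerDl ltW.
  by move=> p _; exact: nonneg_grid.
move=> /andP[su]; rewrite le_eqVlt => /orP[/eqP ->//|us].
rewrite leNgt; apply/negP => Xu.
have su' : s <= u < s + h by rewrite su.
have [N _ /(_ N (leqnn _))] := grid_detects (cX w) s0 h0 su' Xu.
by apply; exact: H.
Qed.

End paths.

Section staying_nonnegative.
Context {R : realType} {d} {Om : measurableType d} {P : probability Om R}.
Variables (X : R -> {RV P >-> R}).
Implicit Types (s t h : R) (F : R -> \bar R) (A : set Om)
  (l : seq (R * set R)).
Local Notation Xf := (fun u => X u : Om -> R).

Lemma measurable_compX F u : measurable_fun [set: R] F ->
  measurable_fun setT (fun w => F (X u w)).
Proof. by move=> mF; apply: measurableT_comp mF _; exact: measurable_funPT. Qed.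

Lemma past_ge0 s u : 0 <= u <= s -> past X s [set w | 0 <= X u w].
Proof.
move=> us; have -> : [set w | 0 <= X u w] = X u @^-1` `[0, +oo[.
  by apply/seteqP; split => w /=; rewrite in_itv/= andbT.
exact: past_preimage.
Qed.

Lemma past_grid s e n t : 0 <= s -> 0 <= e -> s + n%:R * e <= t + e ->
  past X t (grid Xf s e n).
Proof.
move=> s0 e0 st; apply: past_bigcap => i /= iN; apply: past_ge0.
rewrite addr_ge0 ?mulr_ge0//=.
have : i.+1%:R * e <= n%:R * e by rewrite ler_wpM2r// ler_nat.
by rewrite -natr1 mulrDl mul1r; lra.
Qed.

Hypothesis hX : brownian_motion_with_drift 1 X.

Lemma brownian_continuous w : continuous_path Xf w.
Proof. by have [_ _ _] := hX; exact. Qed.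

Lemma past_nonneg s h : 0 <= s -> 0 < h -> past X (s + h) (nonneg Xf s (s + h)).
Proof.
move=> s0 h0; rewrite nonnegE//; last exact: brownian_continuous.
apply: pastI; first by apply: past_ge0; rewrite lexx andbT addr_ge0// ltW.
apply: past_bigcap => p _; apply: past_grid => //.
  exact/ltW/grid_step_gt0.
by rewrite grid_sizeM lerDl ltW// grid_step_gt0.
Qed.

Lemma integral_restrict_preimage (f : Om -> R) A (B : set R) F :
  (\int[P]_(w in A) (F \_ B) (f w) = \int[P]_(w in A `&` f @^-1` B) F (f w))%E.
Proof.
by rewrite integral_mkcondr; apply: eq_integral.
Qed.

Lemma grid_prob s e n A F : 0 <= s -> 0 < e -> past X s A -> unit_fun F ->
  (\int[P]_(w in A `&` grid Xf s e n) F (X (s + n%:R * e) w) =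
   \int[P]_(w in A) iter n (killed_step e) F (X s w))%E.
Proof.
move=> s0 e0 sA uF; elim: n s A s0 sA => [|n IH] s A s0 sA.
  by rewrite mul0r addr0 /grid II0 bigcap_set0 setIT.
have uI := unit_fun_iter_killed n e0 uF.
have sB : past X s (A `&` X s @^-1` `[0, +oo[%classic).
  by apply: pastI => //; apply: past_preimage => //; rewrite s0 lexx.
rewrite iterS integral_restrict_preimage.
have se : s < s + e by rewrite ltrDl.
have := past_transition hX s0 se sB (proj1 uI) (unit_fun_ge0 uI).
have -> : s + e - s = e by lra.
move=> <-; rewrite -IH; [|by rewrite addr_ge0// ltW|exact: past_le (ltW se) sB].
have -> : s + e + n%:R * e = s + n.+1%:R * e.
  by rewrite -natr1 mulrDl mul1r; lra.
congr (integral _ _ _); rewrite gridS setIA; congr (_ `&` _ `&` _).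
by apply/seteqP; split => w /=; rewrite in_itv/= andbT.
Qed.

(** Both sides are limits for fine grids: the left one because a continuous path
that turns negative is seen to do so by every fine enough grid, the right one by
[iter_killed_cvg]. *)
Lemma killed_prob s h A F : 0 <= s -> 0 < h -> past X s A -> unit_fun F ->
  (forall z, z < 0 -> F z = 0%E) ->
  (\int[P]_(w in A `&` nonneg Xf s (s + h)) F (X (s + h) w) =
   \int[P]_(w in A) killed h F (X s w))%E.
Proof.
move=> s0 h0 sA uF F0; have mA := past_measurable sA.
have mFX := measurable_compX (s + h) (proj1 uF).
have d0 p := grid_step_gt0 p h0.
pose G p := grid Xf s (grid_step h p) (grid_size p).
have mG p : measurable (G p).
  apply: (@past_measurable _ _ _ _ X (s + h)).
  by apply: past_grid => //; [exact: ltW|rewrite grid_sizeM lerDl ltW].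
have uFX w : (0 <= F (X (s + h) w) <= 1)%E by case: uF.
pose f p := (fun w => F (X (s + h) w)) \_ (G p).
have mf p : measurable_fun setT (f p).
  exact: measurable_patch.
have f01 p w : (0 <= f p w <= 1)%E.
  by rewrite /f patchE; case: ifP => _ //; rewrite lexx lee01.
have cf w : f ^~ w @ \oo -->
    ((fun w => F (X (s + h) w)) \_ (nonneg Xf s (s + h))) w.
  rewrite patchE; case: ifPn => [/set_mem wN|/negP wN].
    apply: cvg_near_cst; apply: nearW => p.
    by rewrite /f patchE mem_set//; exact: nonneg_grid.
  have [Xsh|Xsh] := ltP (X (s + h) w) 0.
    apply: cvg_near_cst; apply: nearW => p.
    by rewrite /f patchE F0//; case: ifP.
  have [u /andP[su ush] Xu] : exists2 u, s <= u < s + h & X u w < 0.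
    apply: contrapT => H; apply: wN; apply/mem_set => u /andP[su].
    rewrite le_eqVlt => /orP[/eqP -> //|ush].
    rewrite leNgt; apply/negP => Xu; apply: H; exists u => //.
    by rewrite su.
  apply: cvg_near_cst.
  have su' : s <= u < s + h by rewrite su.
  have := grid_detects (@brownian_continuous w) s0 h0 su' Xu.
  apply: filterS => p Hp.
  by rewrite /f patchE memNset.
have uU p := unit_fun_iter_killed (grid_size p) (d0 p) uF.
have L1 := cvg_integral_unit (P := P) mA mf f01 cf.
have L2 := @cvg_integral_unit _ _ _ P A
  (fun p w => iter (grid_size p) (killed_step (grid_step h p)) F (X s w))
  (fun w => killed h F (X s w)) mA
  (fun p => measurable_compX s (proj1 (uU p))) (fun p w => proj2 (uU p) (X s w))
  (fun w => @iter_killed_cvg _ h F (X s w) h0 uF F0).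
rewrite integral_mkcondr.
suff E : (fun p => \int[P]_(w in A) f p w)%E = (fun p => \int[P]_(w in A)
    iter (grid_size p) (killed_step (grid_step h p)) F (X s w))%E.
  rewrite E in L1; exact: (cvg_unique _ L1 L2).
apply/funext => p; rewrite -integral_mkcondr -(grid_prob _ _ (d0 p))//.
by rewrite grid_sizeM.
Qed.

End staying_nonnegative.

(** * Paths observed along a schedule *)

Section hits.
Context {R : realType} {T : Type}.
Implicit Types (X Y : R -> T -> R) (s t u h : R) (l : seq (R * set R)).

Fixpoint hits Y s l : set T := if l is (h, B) :: l'
  then Y (s + h) @^-1` B `&` hits Y (s + h) l' else setT.

Fixpoint horizon s l : R := if l is (h, B) :: l' then horizon (s + h) l' else s.

(** The path reflected after its last negative value before [t]. The change of
sign is decided by the future up to [t] only, which makes the kernels of the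
previous parts applicable. *)
Definition flip X t u w : R := if w \in nonneg X u t then - X u w else X u w.

Lemma horizon_ge s l : admissible l -> s <= horizon s l.
Proof.
elim: l s => //= -[h B] l IH s /admissible_cons[/= h0 _ lP].
by apply: le_trans (IH _ lP); rewrite lerDl ltW.
Qed.

Lemma horizon_gt s l : admissible l -> l != [::] -> s < horizon s l.
Proof.
case: l => //= -[h B] l /admissible_cons[/= h0 _ lP] _.
by apply: lt_le_trans (horizon_ge _ lP); rewrite ltrDl.
Qed.

Lemma hits_ext Y Y' s l w : admissible l ->
  (forall u, s <= u <= horizon s l -> Y u w = Y' u w) ->
  hits Y s l w -> hits Y' s l w.
Proof.
elim: l s => //= -[h B] l IH s /admissible_cons[/= h0 _ lP] YY' [YB Yl].
have sh : s <= s + h by rewrite lerDl ltW.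
split; last first.
  apply: IH => // u /andP[su uT]; apply: YY'.
  by rewrite (le_trans sh su).
by rewrite /= -YY'// sh/= horizon_ge.
Qed.

Lemma nonneg_split X s t u : s <= t -> t <= u ->
  nonneg X s u = nonneg X s t `&` nonneg X t u.
Proof.
move=> st tu; apply/seteqP; split => w.
  move=> H; split => v /andP[sv vt]; apply: H; apply/andP; split => //.
    exact: le_trans tu.
  exact: le_trans sv.
move=> [H1 H2] v /andP[sv vu]; have [vt|tv] := leP v t.
  by apply: H1; rewrite sv.
by apply: H2; rewrite (ltW tv).
Qed.

Lemma nonneg_refl X s : nonneg X s s = [set w | 0 <= X s w].
Proof.
apply/seteqP; split => w; first by apply; rewrite lexx.
by move=> H u /andP[su us]; rewrite (@le_anti _ _ u s)// us.
Qed.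

Lemma ge0_preimage (f : T -> R) : [set w | 0 <= f w] = f @^-1` `[0, +oo[.
Proof. by apply/seteqP; split => w /=; rewrite in_itv/= andbT. Qed.

Lemma flip_nonneg X t u v w : nonneg X u t w -> u <= v -> flip X t v w = - X v w.
Proof.
move=> H uv; rewrite /flip mem_set// => r /andP[vr rt].
by apply: H; rewrite (le_trans uv).
Qed.

Lemma flipN X t u w : ~ nonneg X u t w -> flip X t u w = X u w.
Proof. by move=> H; rewrite /flip memNset. Qed.

End hits.

Section schedule_prob.
Context {R : realType} {d} {Om : measurableType d} {P : probability Om R}.
Implicit Types (s t h : R) (F : R -> \bar R) (A : set Om)
  (l : seq (R * set R)).

Lemma measurable_hits (Y : R -> Om -> R) s l :
  (forall u, 0 <= u -> measurable_fun setT (Y u)) -> 0 <= s -> admissible l ->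
  measurable (hits Y s l).
Proof.
move=> mY; elim: l s => //= -[h B] l IH s s0 /admissible_cons[/= h0 mB lP].
have sh : 0 <= s + h by rewrite addr_ge0// ltW.
apply: measurableI; last exact: IH.
by rewrite -[X in measurable X]setTI; exact: mY.
Qed.

Section upward.
Variable X : R -> {RV P >-> R}.
Hypothesis hX : brownian_motion_with_drift 1 X.
Local Notation Xf := (fun u => X u : Om -> R).

Lemma past_transition1 s h A F : 0 <= s -> 0 < h -> past X s A -> unit_fun F ->
  (\int[P]_(w in A) F (X (s + h) w) =
   \int[P]_(w in A) transition 1 h F (X s w))%E.
Proof.
move=> s0 h0 sA uF; have sh : s < s + h by rewrite ltrDl.
have := past_transition hX s0 sh sA (proj1 uF) (unit_fun_ge0 uF).
by have -> : s + h - s = h by lra.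
Qed.

Lemma measurable_nonneg u t : 0 <= u -> measurable (nonneg Xf u t).
Proof.
move=> u0; have [ut|tu|->] := ltrgtP u t.
- have -> : t = u + (t - u) by lra.
  apply: (@past_measurable _ _ _ _ X (u + (t - u))); apply: past_nonneg => //.
  by rewrite subr_gt0.
- rewrite (_ : nonneg _ _ _ = setT); first exact: measurableT.
  apply/seteqP; split => // w _ v /andP[uv vt].
  by move: (lt_le_trans tu uv); rewrite ltNge vt.
- by rewrite nonneg_refl ge0_preimage; exact: measurable_preimageX.
Qed.

Lemma measurable_flip t u : 0 <= u -> measurable_fun setT (flip Xf t u).
Proof.
move=> u0; rewrite (_ : flip _ _ _ = (fun w => X u w * (1 - 2 * \1_(nonneg Xf u t) w))).
  apply: measurable_funM; first exact: measurable_funPT.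
  apply: measurable_funB => //; apply: measurable_funM => //.
  by apply: measurable_indic; exact: measurable_nonneg.
by apply/funext => w; rewrite /flip indicE; case: ifP => _ /=; lra.
Qed.

(** Subtract [killed_prob] from the Markov property. *)
Lemma visiting_prob s h A F : 0 <= s -> 0 < h -> past X s A -> unit_fun F ->
  (forall z, z < 0 -> F z = 0%E) ->
  (\int[P]_(w in A `&` ~` nonneg Xf s (s + h)) F (X (s + h) w) =
   \int[P]_(w in A) visiting h F (X s w))%E.
Proof.
move=> s0 h0 sA uF F0; have mA := past_measurable sA.
have mN := past_measurable (past_nonneg hX s0 h0).
have mFX := measurable_compX X (s + h) (proj1 uF).
have uK := unit_fun_killed h0 uF F0.
have E := killed_prob hX s0 h0 sA uF F0.
have kfin : (\int[P]_(w in A) killed h F (X s w))%E \is a fin_num.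
  rewrite ge0_fin_numE; last by apply: integral_ge0 => w _; exact: unit_fun_ge0.
  apply: (@le_lt_trans _ _ (\int[P]_(w in A) cst 1 w)%E).
    apply: ge0_le_integral => //.
    - by move=> w _; exact: unit_fun_ge0.
    - exact: measurable_funTS (measurable_compX X s (proj1 uK)).
    - by move=> w _; exact: unit_fun_le1.
  rewrite integral_cst// mul1e (le_lt_trans (probability_le1 _ mA))//.
  by rewrite ltry.
have := past_transition1 s0 h0 sA uF.
have -> : (\int[P]_(w in A) transition 1 h F (X s w) =
    \int[P]_(w in A) killed h F (X s w) +
    \int[P]_(w in A) visiting h F (X s w))%E.
  rewrite -ge0_integralD//.
  - by apply: eq_integral => w _; rewrite killed_visiting.
  - by move=> w _; exact: unit_fun_ge0.
  - exact: measurable_funTS (measurable_compX X s (proj1 uK)).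
  - by move=> w _; exact: visiting_ge0.
  - exact: measurable_funTS (measurable_compX X s (measurable_visiting h0 uF)).
have -> : (\int[P]_(w in A) F (X (s + h) w) =
    \int[P]_(w in A `&` nonneg Xf s (s + h)) F (X (s + h) w) +
    \int[P]_(w in A `&` ~` nonneg Xf s (s + h)) F (X (s + h) w))%E.
  rewrite -ge0_integral_setU//=.
  - by rewrite -setIUr setUv setIT.
  - exact: measurableI.
  - by apply: measurableI => //; exact: measurableC.
  - exact: measurable_funTS.
  - by move=> w _; exact: unit_fun_ge0.
  - apply/disj_setPS => w [[_ Nw] [_]]; exact.
rewrite E addeC [RHS]addeC => /(congr1 (fun r => r - \int[P]_(w in A) killed h F (X s w))%E).
by rewrite !addeK.
Qed.

Lemma opposite_prob l s A : 0 <= s -> admissible l -> past X s A ->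
  P (A `&` nonneg Xf s (horizon s l) `&` hits (fun u w => - X u w) s l) =
  (\int[P]_(w in A) opposite l (X s w))%E.
Proof.
elim: l s A => [|[h B] l IH] s A s0.
  move=> _ sA; rewrite setIT nonneg_refl /= integral_restrict_preimage.
  have mA := past_measurable sA.
  rewrite ge0_preimage integral_cst ?mul1e//; apply: measurableI => //.
  exact: measurable_preimageX.
move=> /admissible_cons[/= h0 mB lP] sA.
have sh : s <= s + h by rewrite lerDl ltW.
have sh0 : 0 <= s + h by exact: le_trans sh.
have mB' := measurable_oppr_preimage mB.
have uO := unit_fun_restrict mB' (unit_fun_opposite lP).
rewrite -(killed_prob hX s0 h0 sA uO) => [|z z0]; last exact: opposite_restrict0.
rewrite integral_restrict_preimage -IH//; last first.
  apply: pastI; last by apply: past_preimage => //; rewrite sh0 lexx.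
  by apply: pastI; [exact: past_le sA|exact: past_nonneg].
rewrite (nonneg_split Xf sh (horizon_ge _ lP)); congr (P _).
by apply/seteqP; split => w /=; tauto.
Qed.

(** The two terms of [reflected] tell whether the last negative value lies
before or after the first time of observation. *)
Lemma reflected_prob l s A : 0 <= s -> admissible l -> past X s A ->
  P (A `&` ~` nonneg Xf s (horizon s l) `&` [set w | 0 <= X (horizon s l) w]
     `&` hits (flip Xf (horizon s l)) s l) =
  (\int[P]_(w in A) reflected l (X s w))%E.
Proof.
elim: l s A => [|[h B] l IH] s A s0.
  move=> _ sA; rewrite /= integral_cst// ?mul0e; last exact: past_measurable sA.
  rewrite nonneg_refl setIT (_ : _ `&` _ = set0) ?measure0//.
  by apply/seteqP; split => // w [[_]] /=.
move=> /admissible_cons[/= h0 mB lP] sA.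
have sh : s <= s + h by rewrite lerDl ltW.
have sh0 : 0 <= s + h by exact: le_trans sh.
have mB' := measurable_oppr_preimage mB.
have uO := unit_fun_restrict mB' (unit_fun_opposite lP).
have mA := past_measurable sA.
set t := horizon (s + h) l.
have t0 : 0 <= t by apply: le_trans (horizon_ge _ lP).
have rB0 := ge0_restrict B (reflected_ge0 lP).
have mrB := measurable_patch mB (measurable_reflected lP).
rewrite ge0_integralD//; last 4 first.
- by move=> w _; exact: visiting_ge0.
- exact: measurable_funTS (measurable_compX X s (measurable_visiting h0 uO)).
- by move=> w _; exact: transition_ge0.
- exact: measurable_funTS (measurable_compX X s (measurable_transition 1 h0 mrB rB0)).
rewrite -(visiting_prob s0 h0 sA uO) => [|z z0]; last exact: opposite_restrict0.
have shl : s < s + h by rewrite ltrDl.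
have := past_transition hX s0 shl sA mrB rB0.
have -> : s + h - s = h by lra.
move=> <-; rewrite !integral_restrict_preimage.
rewrite -opposite_prob//; last first.
  apply: pastI; last by apply: past_preimage => //; rewrite sh0 lexx.
  by apply: pastI; [exact: past_le sA|exact: pastC (past_nonneg hX s0 h0)].
rewrite -IH//; last first.
  by apply: pastI; [exact: past_le sA|apply: past_preimage => //; rewrite sh0 lexx].
rewrite -/t -measureU; last 3 first.
- apply: measurableI; last first.
    by apply: measurable_hits => // u _; exact: measurableT_comp.
  apply: measurableI; last exact: measurable_nonneg.
  apply: measurableI; last exact: measurable_preimageX.
  by apply: measurableI => //; exact/measurableC/measurable_nonneg.
- apply: measurableI; last first.
    by apply: measurable_hits => // u; exact: measurable_flip.
  apply: measurableI; last by rewrite ge0_preimage; exact: measurable_preimageX.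
  apply: measurableI; last exact/measurableC/measurable_nonneg.
  by apply: measurableI => //; exact: measurable_preimageX.
- by apply/seteqP; split => // w [[[_ Hw] _] [[[_ +] _] _]]; apply.
congr (P _); rewrite (nonneg_split Xf sh (horizon_ge _ lP)) -/t.
have fN w : nonneg Xf (s + h) t w -> flip Xf t (s + h) w = - X (s + h) w.
  by move=> H; exact: flip_nonneg H (lexx _).
apply/seteqP; split => w /=.
  move=> [[[Aw Nw] Xt] [fB fl]].
  have [N2|N2] := pselect (nonneg Xf (s + h) t w); [left|right].
    rewrite fN// in fB.
    split; [split; [split; [split|]|]|] => //; first by move=> N1; apply: Nw.
    apply: hits_ext fl => // u /andP[su _]; exact: flip_nonneg su.
  by rewrite flipN// in fB.
move=> [[[[[Aw N1] XB] N2] Xl]|[[[[Aw XB] N2] Xt] fl]].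
  split; last split.
  - split; first by split=> // -[].
    by apply: N2; rewrite lexx horizon_ge.
  - by rewrite fN.
  - apply: hits_ext Xl => // u /andP[su _]; exact/esym/(flip_nonneg N2).
by rewrite flipN//; split=> //; split=> //; split=> // -[].
Qed.

End upward.

End schedule_prob.

Lemma probability_integral_cst {R : realType} d (T : measurableType d)
    (P : probability T R) (r : \bar R) : (\int[P]_x cst r x = r)%E.
Proof. by rewrite integral_cst//= probability_setT mule1. Qed.

Section reflected_law.
Context {R : realType}.
Context {dp : measure_display} {Omp : measurableType dp} {Pp : probability Omp R}.
Context {dm : measure_display} {Omm : measurableType dm} {Pm : probability Omm R}.
Variables (Xp : R -> {RV Pp >-> R}) (Xm : R -> {RV Pm >-> R}).
Hypothesis hXp : brownian_motion_with_drift 1 Xp.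
Hypothesis hXm : brownian_motion_with_drift (- 1) Xm.
Implicit Types (s t h : R) (l : seq (R * set R)).
Local Notation Xpf := (fun u => Xp u : Omp -> R).
Local Notation Xmf := (fun u => Xm u : Omm -> R).

Lemma downward_prob l s A : 0 <= s -> admissible l -> past Xm s A ->
  Pm (A `&` hits Xmf s l `&` [set w | Xm (horizon s l) w <= 0]) =
  (\int[Pm]_(w in A) downward l (Xm s w))%E.
Proof.
elim: l s A => [|[h B] l IH] s A s0.
  move=> _ sA; rewrite setIT /= integral_restrict_preimage.
  have mA := past_measurable sA.
  have -> : [set w | Xm s w <= 0] = Xm s @^-1` `]-oo, 0].
    by apply/seteqP; split => w /=; rewrite in_itv.
  rewrite integral_cst ?mul1e//; apply: measurableI => //.
  exact: measurable_preimageX.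
move=> /admissible_cons[/= h0 mB lP] sA.
have shl : s < s + h by rewrite ltrDl.
have sh0 : 0 <= s + h by rewrite addr_ge0// ltW.
have uD := unit_fun_restrict mB (unit_fun_downward lP).
have := past_transition hXm s0 shl sA (proj1 uD) (unit_fun_ge0 uD).
have -> : s + h - s = h by lra.
move=> <-; rewrite integral_restrict_preimage -IH//; last first.
  apply: pastI; first exact: past_le (ltW shl) sA.
  by apply: past_preimage => //; rewrite sh0 lexx.
by rewrite setIA.
Qed.

Lemma nonneg_hits_null l : admissible l -> l != [::] ->
  Pp (nonneg Xpf 0 (horizon 0 l) `&` hits (fun u w => - Xp u w) 0 l) = 0%E.
Proof.
move=> lP l0; have [X0 _ _ _] := hXp.
have := opposite_prob hXp (lexx 0) lP (@pastT _ _ _ _ Xp 0).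
rewrite setTI => ->; rewrite (eq_integral (cst 0%E)) ?integral0// => w _.
by rewrite X0 (reflected_at0 lP l0).1.
Qed.

(** Since [0] is its own mirror image, the killed kernel vanishes there. *)
Lemma nonneg_null t : 0 < t -> Pp (nonneg Xpf 0 t) = 0%E.
Proof.
move=> t0; have lP : admissible [:: (t, [set: R])].
  exact: admissible_consI.
have := nonneg_hits_null lP isT.
by rewrite /= preimage_setT !setIT add0r.
Qed.

(** The finite-horizon form of the reflection identity. The constraint on the
endpoint is needed because a path that ends negative is never reflected. *)
Lemma reflected_law l : admissible l -> l != [::] ->
  Pp ([set w | 0 <= Xp (horizon 0 l) w] `&` hits (flip Xpf (horizon 0 l)) 0 l) =
  Pm (hits Xmf 0 l `&` [set w | Xm (horizon 0 l) w <= 0]).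
Proof.
move=> lP l0; have [Xp0 _ _ _] := hXp; have [Xm0 _ _ _] := hXm.
set t := horizon 0 l; have t0 : 0 < t by exact: horizon_gt.
set E := _ `&` _.
have mE : measurable E.
  apply: measurableI; first by rewrite ge0_preimage; exact: measurable_preimageX.
  by apply: measurable_hits => // u; exact: measurable_flip.
have mN : measurable (nonneg Xpf 0 t) by exact: measurable_nonneg.
have := downward_prob (lexx 0) lP (@pastT _ _ _ _ Xm 0).
rewrite setTI => ->; rewrite (eq_integral (cst (downward l 0))); last first.
  by move=> w _; rewrite Xm0.
rewrite probability_integral_cst -(reflected_at0 lP l0).2.
have := reflected_prob hXp (lexx 0) lP (@pastT _ _ _ _ Xp 0).
rewrite (eq_integral (cst (reflected l 0))); last by move=> w _; rewrite Xp0.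
rewrite probability_integral_cst => <-.
rewrite setTI -setIA -/t -/E setIC.
rewrite -[in LHS](setIT E) -(setUv (nonneg Xpf 0 t)) setIUr measureU//; last 3 first.
- exact: measurableI.
- by apply: measurableI => //; exact: measurableC.
- by apply/seteqP; split => // w [[_ Nw] [_]]; apply.
rewrite [X in (X + _)%E](_ : _ = 0%E) ?add0e//.
apply: (subset_measure0 (B := nonneg Xpf 0 t)) => //.
- exact: measurableI.
- exact: nonneg_null.
Qed.

End reflected_law.

(** * The reflected partner of an upward Brownian motion *)

Section partner.
Context {R : realType} {T : Type}.
Implicit Types (X : R -> T -> R) (s t u v : R) (w : T) (l : seq (R * set R)).

Definition forever X t : set T :=
  [set w | forall u, 0 <= u -> t <= u -> 0 <= X u w].

(** The partner leaves the path at the time after which the path no longer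
takes negative values; it is the limit of [flip X t] for large [t]. *)
Definition partner X t w : R := if w \in forever X t then - X t w else X t w.

Lemma forever_le X s t w : s <= t -> forever X s w -> forever X t w.
Proof. by move=> st H u u0 tu; apply: H => //; exact: le_trans tu. Qed.

Lemma foreverE X t : forever X t = \bigcap_n nonneg X (Num.max 0 t) n%:R.
Proof.
apply/seteqP; split => [w H n _ u /andP[]|w H u u0 tu].
  by rewrite ge_max => /andP[u0 tu] _; exact: H.
have [n un] : exists n : nat, u <= n%:R.
  by exists (Num.truncn u).+1; exact/ltW/truncnS_gt.
by apply: (H n) => //; rewrite ge_max u0 tu.
Qed.

(** The change of sign happens where the path vanishes: elsewhere, membership
in [forever X] is locally constant in time. *)
Lemma continuous_path_partner X w : continuous_path X w ->
  continuous_path (partner X) w.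
Proof.
move=> cX; have /continuous_pathP cXP := cX.
apply/continuous_pathP => x x0 e e0; have [r r0 Hr] := cXP x x0 e e0.
have [X0|X0] := eqVneq (X x w) 0.
  exists r => // v v0 /(Hr v v0).
  rewrite /partner X0 oppr0 if_same !sub0r !normrN.
  by case: ifP; rewrite ?normrN.
have [xF|xF] := pselect (forever X x w).
  have Xx : 0 < X x w by rewrite lt_neqAle eq_sym X0 xF.
  have [q q0 Hq] := cXP x x0 _ Xx.
  exists (Num.min r q) => [|v v0]; first by rewrite lt_min r0.
  rewrite lt_min => /andP[xr xq]; rewrite /partner (mem_set xF) mem_set.
    by rewrite -opprD normrN Hr.
  move=> u u0 vu; have [xu|ux] := leP x u; first exact: xF.
  have /(Hq u u0) : `|x - u| < q.
    rewrite ger0_norm ?subr_ge0 ?(ltW ux)//; apply: le_lt_trans xq.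
    rewrite ger0_norm ?subr_ge0; first by rewrite lerB.
    by apply: le_trans (ltW ux).
  by rewrite ltr_norml => /andP[_]; rewrite ltrBlDl ltrDr => /ltW.
have [u [u0 xu Xu]] : exists u, [/\ 0 <= u, x <= u & X u w < 0].
  apply: contrapT => H; apply: xF => u u0 xu; rewrite leNgt; apply/negP => Xu.
  by apply: H; exists u.
have [q q0 Hq] : exists2 q : R, 0 < q & forall t, 0 <= t -> `|x - t| < q ->
    ~ forever X t w.
  move: xu; rewrite le_eqVlt => /orP[/eqP xu|xu].
    have [q q0 Hq] := negative_near cX u0 Xu.
    exists q => // t t0; rewrite xu => /(Hq _ t0) Xt /(_ t t0 (lexx _)).
    by rewrite leNgt Xt.
  exists (u - x); first by rewrite subr_gt0.
  move=> t t0 xt H; have tu : t <= u.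
    by move: xt; rewrite ltr_distlC => /andP[_]; rewrite subrKC => /ltW.
  by have := H u u0 tu; rewrite leNgt Xu.
exists (Num.min r q) => [|v v0]; first by rewrite lt_min r0.
rewrite lt_min => /andP[xr xq]; rewrite /partner (memNset xF) memNset.
  exact: Hr.
exact: Hq.
Qed.

Lemma flip_partner X u w : 0 <= u ->
  exists v, forall t, v <= t -> flip X t u w = partner X u w.
Proof.
move=> u0; have [uF|uF] := pselect (forever X u w).
  exists 0 => t _; rewrite /partner (mem_set uF) /flip mem_set// => v /andP[uv _].
  by apply: uF => //; exact: le_trans uv.
have [v [v0 uv Xv]] : exists v, [/\ 0 <= v, u <= v & X v w < 0].
  apply: contrapT => H; apply: uF => v v0 uv; rewrite leNgt; apply/negP => Xv.
  by apply: H; exists v.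
exists v => t vt; rewrite /partner (memNset uF) flipN// => /(_ v).
by rewrite uv vt leNgt Xv => /(_ isT).
Qed.

Lemma hits_flip_partner X l s w : 0 <= s -> admissible l ->
  exists v, forall t, v <= t -> hits (flip X t) s l w <-> hits (partner X) s l w.
Proof.
elim: l s => [|[h B] l IH] s s0; first by exists 0.
move=> /admissible_cons[/= h0 mB lP].
have sh0 : 0 <= s + h by rewrite addr_ge0// ltW.
have [v1 H1] := IH _ sh0 lP; have [v2 H2] := flip_partner X w sh0.
exists (Num.max v1 v2) => t; rewrite ge_max => /andP[/H1 {}H1 /H2 {}H2].
by rewrite /= H2; split=> -[? /H1].
Qed.

(** An observation without constraint prolongs the horizon of a schedule. *)
Lemma hits_rcons (Y : R -> T -> R) s l h :
  hits Y s (rcons l (h, setT)) = hits Y s l.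
Proof.
elim: l s => [|[k B] l IH] s /=; first by rewrite preimage_setT setIT.
by rewrite IH.
Qed.

Lemma horizon_rcons s l h (B : set R) :
  horizon s (rcons l (h, B)) = horizon s l + h.
Proof. by elim: l s => [|[k C] l IH] s //=. Qed.

End partner.

Lemma admissible_rcons {R : realType} (l : seq (R * set R)) h :
  0 < h -> admissible l -> admissible (rcons l (h, setT)).
Proof.
move=> h0 lP a; rewrite mem_rcons in_cons => /orP[/eqP ->|/lP//].
by split=> //; exact: measurableT.
Qed.

(** The schedule that observes at the times [us], starting from time [s]. *)
Fixpoint schedule {R : realType} (C : R -> set R) s us : seq (R * set R) :=
  if us is u :: us' then (u - s, C u) :: schedule C u us' else [::].

Lemma admissible_schedule {R : realType} (C : R -> set R) s us :
  (forall u, measurable (C u)) -> path <%R s us -> admissible (schedule C s us).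
Proof.
move=> mC; elim: us s => [|u us IH] s /=; first by move=> _; exact: admissible_nil.
by move=> /andP[su /IH]; apply: admissible_consI => //; rewrite subr_gt0.
Qed.

Lemma hits_schedule {R : realType} {T : Type} (Y : R -> T -> R) C s us :
  hits Y s (schedule C s us) = \bigcap_(u in [set` us]) Y u @^-1` C u.
Proof.
elim: us s => [|u us IH] s /=.
  by apply/seteqP; split.
rewrite subrKC IH; apply/seteqP; split => [w [Yu H] v|w H].
  by rewrite /= in_cons => /orP[/eqP ->|/H].
split; first by apply: (H u); rewrite /= mem_head.
by move=> v vus; apply: (H v); rewrite /= in_cons vus orbT.
Qed.

Lemma cvg_setI_full {R : realType} d (T : measurableType d)
    (P : probability T R) (E G : (set T)^nat) (r : \bar R) :
  (forall n, measurable (E n)) -> (forall n, measurable (G n)) ->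
  P (~` G n) @[n --> \oo] --> 0%E -> P (E n) @[n --> \oo] --> r ->
  P (E n `&` G n) @[n --> \oo] --> r.
Proof.
move=> mE mG G0 Er.
apply: (@squeeze_cvge _ _ _ _ (fun n => P (E n) - P (~` G n))%E _ (fun n => P (E n))) => //.
  apply: nearW => n; apply/andP; split; last first.
    by apply: le_measure; rewrite ?inE//; exact: measurableI.
  have mC := measurableC (mG n).
  rewrite leeBlDr ?fin_num_measure//.
  apply: le_trans (measureU2 P (measurableI _ _ (mE n) (mG n)) mC).
  apply: le_measure; rewrite ?inE//.
    by apply: measurableU => //; exact: measurableI.
  by move=> w Ew; have [Gw|Gw] := pselect (G n w); [left|right].
by rewrite -[r]sube0; apply: cvgeB => //; rewrite fin_num_adde_defl.
Qed.

(** * The law of the partner *)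

Section partner_process.
Context {R : realType}.
Context {dp : measure_display} {Omp : measurableType dp} {Pp : probability Omp R}.
Context {dm : measure_display} {Omm : measurableType dm} {Pm : probability Omm R}.
Variables (Xp : R -> {RV Pp >-> R}) (Xm : R -> {RV Pm >-> R}).
Hypothesis hXp : brownian_motion_with_drift 1 Xp.
Hypothesis hXm : brownian_motion_with_drift (- 1) Xm.
Implicit Types (s t h : R) (l : seq (R * set R)).
Local Notation Xpf := (fun u => Xp u : Omp -> R).
Local Notation Xmf := (fun u => Xm u : Omm -> R).

Lemma measurable_forever t : measurable (forever Xpf t).
Proof.
rewrite foreverE; apply: bigcapT_measurable => n; apply: measurable_nonneg => //.
by rewrite le_max lexx.
Qed.

Lemma measurable_partner t : measurable_fun setT (partner Xpf t).
Proof.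
rewrite (_ : partner _ _ = (fun w => Xp t w * (1 - 2 * \1_(forever Xpf t) w))).
  apply: measurable_funM; first exact: measurable_funPT.
  apply: measurable_funB => //; apply: measurable_funM => //.
  by apply: measurable_indic; exact: measurable_forever.
by apply/funext => w; rewrite /partner indicE; case: ifP => _ /=; lra.
Qed.

Definition partner_rv t : {RV Pp >-> R} :=
  HB.pack (partner Xpf t) (isMeasurableFun.Build _ _ _ _ _ (measurable_partner t)).

Lemma brownian_at d (Om : measurableType d) (P : probability Om R) b
    (X : R -> {RV P >-> R}) t (B : set R) :
  brownian_motion_with_drift b X -> 0 < t -> measurable B ->
  P (X t @^-1` B) = normal_prob (b * t) (Num.sqrt t) B.
Proof.
move=> [X0 _ nX _] t0 mB; have := nX 0 t B (lexx 0) t0 mB; rewrite subr0 => <-.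
by congr (P _); apply/seteqP; split => w; rewrite /= /increment/= X0 subr0.
Qed.

Lemma tail_up t : 0 < t ->
  (Pp (~` [set w | (0 <= Xp t w)%R]) <= (expR (- (t / 2)))%:E)%E.
Proof.
move=> t0; have -> : ~` [set w | (0 <= Xp t w)%R] = Xp t @^-1` `]-oo, 0[.
  by apply/seteqP; split => w /=; rewrite in_itv/= ltNge => /negP.
rewrite (brownian_at hXp)//.
apply: le_trans (normal_prob_tail (L := -1) (x := 0) _ (sqrt_neq0 t0) _ _) _.
- exact: measurable_itv.
- by move=> z; rewrite /= in_itv/= => z0; lra.
by rewrite lee_fin ler_expR sqr_sqrtr ?(ltW t0)//; lra.
Qed.

Lemma tail_down t : 0 < t ->
  (Pm (~` [set w | (Xm t w <= 0)%R]) <= (expR (- (t / 2)))%:E)%E.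
Proof.
move=> t0; have -> : ~` [set w | (Xm t w <= 0)%R] = Xm t @^-1` `]0, +oo[.
  by apply/seteqP; split => w /=; rewrite in_itv/= andbT ltNge => /negP.
rewrite (brownian_at hXm)//.
apply: le_trans (normal_prob_tail (L := 1) (x := 0) _ (sqrt_neq0 t0) _ _) _.
- exact: measurable_itv.
- by move=> z; rewrite /= in_itv/= andbT => z0; lra.
by rewrite lee_fin ler_expR sqr_sqrtr ?(ltW t0)//; lra.
Qed.

Lemma expR_half_cvg0 c : 0 <= c ->
  (expR (- ((c + n.+1%:R) / 2)))%:E @[n --> \oo] --> (0 : \bar R)%E.
Proof.
move=> c0; apply: cvg_EFin; first exact: nearW.
apply: (@squeeze_cvgr _ _ _ _ (cst 0) (fun n => 2 * harmonic n)).
- apply: nearW => n; rewrite expR_ge0/= expRN.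
  have n0 : 0 < n.+1%:R :> R by rewrite ltr0n.
  have -> : 2 * n.+1%:R^-1 = (n.+1%:R / 2)^-1 :> R by rewrite invf_div.
  rewrite lef_pV2 ?posrE ?expR_gt0 ?divr_gt0//.
  by apply: le_trans (expR_ge1Dx _); lra.
- exact: cvg_cst.
- rewrite -[X in _ --> X](mulr0 2).
  by apply: cvgM; [exact: cvg_cst|exact: cvg_harmonic].
Qed.

(** Let the horizon tend to infinity in [reflected_law]: the constraints on the
sign of the endpoint become almost sure because of the drifts. *)
Lemma partner_hits l : admissible l ->
  Pp (hits (partner Xpf) 0 l) = Pm (hits Xmf 0 l).
Proof.
move=> lP; set c := horizon 0 l; have c0 : 0 <= c by exact: horizon_ge.
pose t n := c + n.+1%:R; have t0 n : 0 < t n by rewrite ltr_wpDl.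
pose l' n := rcons l (n.+1%:R, [set: R]).
have lP' n : admissible (l' n) by exact: admissible_rcons.
have lN n : l' n != [::] by rewrite /l'; case: (l).
pose E n := hits (flip Xpf (t n)) 0 l.
pose Gp n := [set w | (0 <= Xp (t n) w)%R].
pose Gm n := [set w | (Xm (t n) w <= 0)%R].
have mE n : measurable (E n).
  by apply: measurable_hits => // u; exact: measurable_flip.
have mH : measurable (hits (partner Xpf) 0 l).
  by apply: measurable_hits => // u _; exact: measurable_partner.
have mHm : measurable (hits Xmf 0 l).
  by apply: measurable_hits => // u _; exact: measurable_funPT.
have mGp n : measurable (Gp n).
  by rewrite /Gp ge0_preimage; exact: measurable_preimageX.
have mGm n : measurable (Gm n).
  rewrite (_ : Gm n = Xm (t n) @^-1` `]-oo, 0]); first exact: measurable_preimageX.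
  by apply/seteqP; split => w /=; rewrite in_itv.
have EG n : Pp (E n `&` Gp n) = Pm (hits Xmf 0 l `&` Gm n).
  have := reflected_law hXp hXm (lP' n) (lN n).
  by rewrite /l' horizon_rcons !hits_rcons setIC.
have cE : Pp (E n) @[n --> \oo] --> Pp (hits (partner Xpf) 0 l).
  have IE A : measurable A -> Pp A = (\int[Pp]_(w in setT) (\1_A w)%:E)%E.
    by move=> mA; rewrite integral_indic// setIT.
  under eq_fun do rewrite IE//; rewrite IE//.
  apply: cvg_integral_unit => // [n|n w|w].
  - by apply/measurable_EFinP; exact: measurable_indic.
  - by rewrite !lee_fin indicE ler0n lern1 leq_b1.
  - have [v Hv] := hits_flip_partner Xpf w (lexx 0) lP.
    apply: cvg_near_cst; near=> n; have /Hv H : v <= t n.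
      rewrite /t; apply: (@le_trans _ _ n.+1%:R); last by rewrite lerDr.
      near: n; exists (Num.truncn v) => // n /= vn.
      by apply/ltW/(lt_le_trans (truncnS_gt v)); rewrite ler_nat ltnS.
    by congr (_%:E); rewrite !indicE; congr (nat_of_bool _)%:R;
      apply/idP/idP; rewrite !inE => /H.
have cp : Pp (~` Gp n) @[n --> \oo] --> 0%E.
  apply: (squeeze_cvge _ (cvg_cst _) (expR_half_cvg0 c0)).
  by apply: nearW => n; rewrite measure_ge0/=; exact: tail_up.
have cm : Pm (~` Gm n) @[n --> \oo] --> 0%E.
  apply: (squeeze_cvge _ (cvg_cst _) (expR_half_cvg0 c0)).
  by apply: nearW => n; rewrite measure_ge0/=; exact: tail_down.
have L1 := cvg_setI_full mE mGp cp cE.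
have L2 : Pm (hits Xmf 0 l `&` Gm n) @[n --> \oo] --> Pm (hits Xmf 0 l).
  by apply: (cvg_setI_full (E := fun=> hits Xmf 0 l)) => //; exact: cvg_cst.
move: L1; under eq_fun do rewrite EG; move=> L1; exact: (cvg_unique _ L1 L2).
Unshelve. all: by end_near. Qed.

(** The times are arbitrary here: they may be repeated, unsorted, or [0]. *)
Lemma partner_fdd (L : seq R) (C : R -> set R) :
  (forall u, u \in L -> 0 <= u) -> (forall u, measurable (C u)) ->
  Pp (\bigcap_(u in [set` L]) partner Xpf u @^-1` C u) =
  Pm (\bigcap_(u in [set` L]) Xm u @^-1` C u).
Proof.
move=> L0 mC; have [Xp0 _ _ _] := hXp; have [Xm0 _ _ _] := hXm.
pose us := sort <=%R (undup [seq u <- L | 0 < u]).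
have us_mem u : u \in us = (u \in L) && (0 < u).
  by rewrite mem_sort mem_undup mem_filter andbC.
have us_path : path <%R 0 us.
  rewrite path_min_sorted; first by rewrite sort_lt_sorted undup_uniq.
  by apply/allP => u; rewrite us_mem => /andP[].
have splitL T (Y : R -> T -> R) : (forall w, Y 0 w = 0) ->
    \bigcap_(u in [set` L]) Y u @^-1` C u =
    if (0 \in L) ==> (0 \in C 0) then hits Y 0 (schedule C 0 us) else set0.
  move=> Y0; case: ifPn => [C0|]; rewrite ?hits_schedule.
    apply/seteqP; split => w H u /=.
      by rewrite us_mem => /andP[uL _]; exact: H.
    move=> uL; have := L0 u uL; rewrite le_eqVlt => /orP[/eqP u0|u0].
      by rewrite -u0 Y0; rewrite u0 uL -u0 in C0; exact: set_mem.
    by apply: (H u); rewrite /= us_mem uL.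
  rewrite negb_imply => /andP[L00 /negP C0].
  apply/seteqP; split => // w /(_ 0 L00); rewrite /= Y0 => ?.
  by apply: C0; exact: mem_set.
rewrite !splitL//; last first.
  by move=> w; rewrite /partner Xp0 oppr0 if_same.
case: ifP => _; last by rewrite !measure0.
by apply: partner_hits; exact: admissible_schedule.
Qed.

Lemma partner_law (D : set R) (A : set (path_space D)) :
  (forall u, D u -> 0 <= u) -> measurable A -> law partner_rv D A = law Xm D A.
Proof.
move=> D0.
have mev (s : D) : measurable_fun setT (fun x : path_space D => x s).
  by move=> _ B mB; apply: sub_sigma_algebra; exists s => //; exists B.
apply: (@gen_measure_unique R D _ (path_space D) setT
    (fun (s : D) (x : path_space D) => x s) (law partner_rv D) (law Xm D)).
- by move=> s _; exact: mev.
- exact: le_lt_trans (probability_le1 _ measurableT) (ltry _).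
move=> _ [L [B [_ mB] ->]].
(* The indices of a box are elements of the subtype [D]; the schedules use plain
   times. *)
pose C u : set R := \bigcap_(s in [set s | s \in L /\ val s = u]) B s.
have mC u : measurable (C u).
  apply: fin_bigcap_measurable => //.
  by apply: (sub_finite_set (B := [set` L])) => [s []//|]; exact: finite_seq.
have boxE T (Y : R -> T -> R) :
    (fun w => (fun s : D => Y (val s) w) : path_space D) @^-1`
      (\bigcap_(s in [set` L]) (fun x : path_space D => x s) @^-1` B s) =
    \bigcap_(u in [set` map val L]) Y u @^-1` C u.
  apply/seteqP; split => [w H u /mapP[s sL ->] s' [s'L <-]|w H s sL].
    exact: (H s' s'L).
  by apply: (H (val s)) => //; apply/mapP; exists s.
have L0 u : u \in map val L -> 0 <= u.
  by move=> /mapP[s _ ->]; apply: D0; exact: set_valP.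
by have := partner_fdd L0 mC; rewrite -!boxE.
Qed.

End partner_process.

(** * The maximal exit coupling *)

Section agreement.
Context {R : realType}.
Implicit Types (s t u : R).

Definition agree {T : Type} (Y Z : R -> T -> R) t : set T :=
  [set w | forall s, 0 <= s < t -> Y s w = Z s w].

(** Continuity reduces agreement to rational times, hence makes it an event. *)
Lemma agree_rational {T : Type} (Y Z : R -> T -> R) t :
  (forall w, continuous_path Y w) -> (forall w, continuous_path Z w) ->
  agree Y Z t = \bigcap_k \bigcap_(i in [set i | i%:R / k.+1%:R < t])
    [set w | Y (i%:R / k.+1%:R) w - Z (i%:R / k.+1%:R) w = 0].
Proof.
move=> cY cZ; apply/seteqP; split => [w H k _ i /= it|w H s /andP[s0 st]].
  by rewrite H ?subrr// it divr_ge0.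
apply/eqP; rewrite -subr_eq0; apply/negP => /negP YZ.
pose e := `|Y s w - Z s w| / 2.
have e0 : 0 < e by rewrite divr_gt0// normr_gt0.
have /continuous_pathP/(_ s s0 e e0)[r1 r10 H1] := cY w.
have /continuous_pathP/(_ s s0 e e0)[r2 r20 H2] := cZ w.
have r0 : 0 < Num.min (Num.min r1 r2) (t - s) by rewrite !lt_min r10 r20 subr_gt0.
have [k _ /(_ k (leqnn _))] := near_infty_natSinv_lt (PosNum r0).
rewrite /= !lt_min => /andP[/andP[kr1 kr2] kt].
have k0 : 0 < k.+1%:R :> R by rewrite ltr0n.
pose i := (Num.truncn (s * k.+1%:R)).+1.
have /andP[i1 i2] : s < i%:R / k.+1%:R <= s + k.+1%:R^-1.
  have /truncn_itv/andP[] : 0 <= s * k.+1%:R by rewrite mulr_ge0// ltW.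
  rewrite -/i ltr_pdivlMr// ler_pdivrMr// => a b; rewrite b mulrDl mulVf ?gt_eqF//=.
  by rewrite /i -natr1 lerD2r.
have v0 : 0 <= i%:R / k.+1%:R :> R by rewrite divr_ge0.
have d : `|s - i%:R / k.+1%:R| <= k.+1%:R^-1.
  by rewrite distrC ger0_norm ?subr_ge0 ?(ltW i1)// lerBlDl.
have vt : i%:R / k.+1%:R < t.
  by apply: (le_lt_trans i2); rewrite -ltrBrDl.
have YZi := H k I i vt; rewrite /= in YZi.
have := H1 _ v0 (le_lt_trans d kr1); have := H2 _ v0 (le_lt_trans d kr2).
rewrite -(subr0_eq YZi) => a b.
suff : `|Y s w - Z s w| < `|Y s w - Z s w| by rewrite ltxx.
rewrite [ltRHS](splitr _) -/e; apply: le_lt_trans (ltrD b a).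
by rewrite -[X in X <= _]normrN opprB distrC -(distrC _ (Z s w)) ler_distD.
Qed.

Lemma measurable_agree d (Om : measurableType d) (Y Z : R -> Om -> R) t :
  (forall u, 0 <= u -> measurable_fun setT (Y u)) ->
  (forall u, 0 <= u -> measurable_fun setT (Z u)) ->
  (forall w, continuous_path Y w) -> (forall w, continuous_path Z w) ->
  measurable (agree Y Z t).
Proof.
move=> mY mZ cY cZ; rewrite agree_rational//; apply: bigcapT_measurable => k.
rewrite bigcap_mkcond; apply: bigcapT_measurable => i.
case: ifP => _; last exact: measurableT.
have v0 : 0 <= i%:R / k.+1%:R :> R by rewrite divr_ge0.
have mD := measurable_funB (mY _ v0) (mZ _ v0).
by rewrite -[X in measurable X]setTI; exact: (mD measurableT [set 0]).
Qed.

End agreement.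

Section left_limit.
Context {R : realType}.
Variable t : R.
Hypothesis t0 : 0 < t.
Local Notation D := (`[0, t[%classic : set R).

Let tau n : R := t - t / n.+1%:R.

Let tau_in n : tau n \in D.
Proof.
have n0 : 0 < n.+1%:R :> R by rewrite ltr0n.
apply/mem_set; rewrite /= in_itv/= /tau subr_ge0 ltrBlDr ltrDl divr_gt0// andbT.
by rewrite ler_pdivrMr// ler_peMr ?(ltW t0)// ler1n.
Qed.

(** A path on [0 <= s < t] does not know its endpoint; by continuity this event
says that the endpoint is negative. *)
Definition left_negative : set (path_space D) :=
  \bigcup_k \bigcup_N \bigcap_(n in [set n | (N <= n)%N])
    [set x : path_space D | x (SigSub (tau_in n)) < - k.+1%:R^-1].

Lemma measurable_left_negative : measurable left_negative.
Proof.
apply: bigcup_measurable => k _; apply: bigcup_measurable => N _.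
apply: bigcap_measurable => [|n _]; first by exists N => /=.
apply: sub_sigma_algebra; exists (SigSub (tau_in n)) => //.
exists `]-oo, (- k.+1%:R^-1)[%classic; first exact: measurable_itv.
by rewrite setTI; apply/seteqP; split => x /=; rewrite in_itv.
Qed.

Lemma left_negativeP {T : Type} (Y : R -> T -> R) w : continuous_path Y w ->
  left_negative (fun s : D => Y (val s) w) <-> Y t w < 0.
Proof.
move=> /continuous_pathP cY; have tge0 := ltW t0.
have tau0 n : 0 <= tau n.
  by have := tau_in n; rewrite inE/= in_itv/= => /andP[].
have tau_near e : 0 < e -> exists N, forall n, (N <= n)%N -> `|t - tau n| < e.
  move=> e0; have et : 0 < e / t by rewrite divr_gt0.
  have [N _ HN] := near_infty_natSinv_lt (PosNum et).
  exists N => n /HN /=; rewrite ltr_pdivlMr// mulrC => H.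
  by rewrite /tau opprB subrKC ger0_norm// divr_ge0.
split=> [[k _ [N _ H]]|Yt].
  rewrite ltNge; apply/negP => Yt.
  have k0 : 0 < k.+1%:R^-1 :> R by rewrite invr_gt0.
  have [r r0 Hr] := cY t tge0 _ k0.
  have [M HM] := tau_near r r0.
  have := H (maxn N M) (leq_maxl _ _); rewrite /= => Y1.
  have := Hr _ (tau0 (maxn N M)) (HM _ (leq_maxr _ _)).
  rewrite ltr_norml => /andP[_]; move: (k.+1%:R^-1) Y1 => q Y1; lra.
have Yt0 : 0 < - Y t w / 2 by rewrite divr_gt0// oppr_gt0.
have [k _ /(_ k (leqnn _))] := near_infty_natSinv_lt (PosNum Yt0).
rewrite /= => kY; have [r r0 Hr] := cY t tge0 _ Yt0.
have [N HN] := tau_near r r0.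
exists k => //; exists N => // n /HN /(Hr _ (tau0 n)).
rewrite ltr_norml => /andP[+ _] /=; move: (k.+1%:R^-1) kY => q kY; lra.
Qed.

End left_limit.

Lemma is_meet_setT d (T : measurableType d) (R : realType)
    (mu nu m m' : {measure set T -> \bar R}) :
  is_meet mu nu m -> is_meet mu nu m' -> m setT = m' setT.
Proof.
move=> [mb mM] [mb' mM']; apply/le_anti/andP; split.
  by apply: mM' => //.
by apply: mM => //.
Qed.

Section mexit.
Context {R : realType}.
Context {dp : measure_display} {Omp : measurableType dp} {Pp : probability Omp R}.
Context {dm : measure_display} {Omm : measurableType dm} {Pm : probability Omm R}.
Variables (Xp : R -> {RV Pp >-> R}) (Xm : R -> {RV Pm >-> R}).
Hypothesis hXp : brownian_motion_with_drift 1 Xp.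
Hypothesis hXm : brownian_motion_with_drift (- 1) Xm.
Local Notation Xpf := (fun u => Xp u : Omp -> R).
Local Notation Ym := (partner_rv hXp).

Let G t := agree Xpf (partner Xpf) t.

Let cX w : continuous_path Xpf w.
Proof. exact: (@brownian_continuous _ _ _ _ _ hXp). Qed.

Let cY w : continuous_path (partner Xpf) w.
Proof. exact: continuous_path_partner. Qed.

Lemma measurable_coupling_agree t : measurable (G t).
Proof.
by apply: measurable_agree => // u _; exact: measurable_partner.
Qed.

Lemma not_forever_agree t w : ~ forever Xpf t w -> G t w.
Proof.
move=> H s /andP[_ st]; rewrite /partner memNset// => Hs.
by apply: H; exact: forever_le (ltW st) Hs.
Qed.

(** The meet on [0 <= s < t] is the law of the path on the event that the two
paths still agree. *)
Let meet_measure t : {measure set (path_space `[0, t[) -> \bar R} :=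
  measure_function_pushforward__canonical__measure_function_Measure
    (mrestr Pp (measurable_coupling_agree t))
    (measurable_sample_path Xp (D := `[0, t[%classic)).

Lemma brownian_neq0 t : 0 < t -> Pp (Xp t @^-1` [set 0]) = 0%E.
Proof.
move=> t0; rewrite (brownian_at hXp)//.
have /null_content_dominatesP H := normal_prob_dominates (1 * t) (Num.sqrt t).
by apply: H => //; exact: countable_lebesgue_measure0.
Qed.

(** Split a set of paths by the sign of the left limit at [t]. Where the first
process ends negative, it still agrees with its partner, so a common minorant is
bounded there by the law of the first process on agreement. Where the partner
does not end negative, the same is true almost surely, since a reflected partner
would end nonpositive; there a common minorant is bounded by the law of the
second process, which is that of the partner. *)
Lemma meet_measureP t : 0 < t ->
  is_meet (law Xp `[0, t[) (law Xm `[0, t[) (meet_measure t).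
Proof.
move=> t0; set D := (`[0, t[%classic : set R).
have D0 u : D u -> 0 <= u by rewrite /D/= in_itv/= => /andP[].
have lawY A : measurable A ->
    (law Xm D : {measure set (path_space D) -> \bar R}) A =
    Pp (sample_path Ym (D := D) @^-1` A).
  by move=> mA; exact: esym (partner_law hXp hXm D0 mA).
have agreeE w : G t w -> sample_path Xp (D := D) w = sample_path Ym (D := D) w.
  move=> Gw; apply/funext => s; apply: Gw.
  by have := set_valP s; rewrite /D/= in_itv.
have msp (Z : R -> {RV Pp >-> R}) A : measurable A ->
    measurable (sample_path Z (D := D) @^-1` A).
  move=> mA; rewrite -[X in measurable X]setTI.
  exact: (measurable_sample_path Z (D := D)).
have mG := measurable_coupling_agree t.
have mE A : meet_measure t A = Pp (sample_path Xp (D := D) @^-1` A `&` G t) by [].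
have leP (E F : set Omp) : measurable E -> measurable F -> E `<=` F ->
    (Pp E <= Pp F)%E.
  by move=> mE' mF EF; apply: le_measure; rewrite ?inE.
split=> [A mA|m' mb A mA].
  rewrite le_min mE; apply/andP; split.
    apply: leP; [exact: measurableI (msp _ _ mA) mG|exact: msp|].
    exact: subIsetl.
  rewrite lawY//; apply: leP.
  - exact: measurableI (msp _ _ mA) mG.
  - exact: msp.
  - by move=> w [Aw Gw]; rewrite /= -agreeE.
pose H := left_negative t0; have mH : measurable H by exact: measurable_left_negative.
have mAH := measurableI _ _ mA mH; have mAH' := measurableD mA mH.
have HP (Z : R -> {RV Pp >-> R}) w : continuous_path (fun u => Z u : Omp -> R) w ->
    H (sample_path Z (D := D) w) <-> Z t w < 0.
  exact: left_negativeP.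
rewrite -(setUIDK A H) !measureU//; last 2 first.
- by apply/seteqP; split => // x [[_ Hx] [_]].
- by apply/seteqP; split => // x [[_ Hx] [_]].
apply: leeD.
  have := mb _ mAH; rewrite le_min => /andP[/le_trans + _]; apply.
  rewrite [leRHS]mE; apply: leP; [exact: msp|exact: measurableI (msp _ _ mAH) mG|].
  move=> w [Aw Hw]; split=> //; apply: not_forever_agree => wF.
  have := (HP Xp w (@cX w)).1 Hw; rewrite ltNge => /negP; apply.
  by apply: wF => //; exact: ltW.
have := mb _ mAH'; rewrite le_min => /andP[_ /le_trans]; apply.
rewrite lawY// [leRHS]mE.
have m0 : measurable (Xp t @^-1` [set 0]) by exact: measurable_preimageX.
have mI := measurableI _ _ (msp Xp _ mAH') mG.
apply: (@le_trans _ _ (Pp ((sample_path Xp (D := D) @^-1` (A `\` H) `&` G t)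
    `|` Xp t @^-1` [set 0]))).
  apply: leP; [exact: msp|exact: measurableU|].
  move=> w AHw; have [_ Hw] := AHw.
  have [X0|X0] := eqVneq (Xp t w) 0; [by right|left].
  suff Gw : G t w by split => //; rewrite /= agreeE.
  apply: not_forever_agree => wF; apply: Hw; apply/(HP Ym w (@cY w)).
  rewrite /= /partner mem_set// oppr_lt0 lt_neqAle eq_sym X0/=.
  by apply: wF => //; exact: ltW.
apply: le_trans (measureU2 _ mI m0) _.
by rewrite [X in (_ + X)%E]brownian_neq0// adde0.
Qed.

Lemma reflection_mexit : is_mexit_coupling Xp Xm Xp Ym.
Proof.
have pos u : (`[0, +oo[%classic : set R) u -> 0 <= u.
  by rewrite /= in_itv/= andbT.
split; first split => //.
- by move=> A mA; exact: (partner_law hXp hXm pos).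
move=> t t0; exists (meet_measure t); split; first exact: meet_measureP.
rewrite [RHS](_ : _ = Pp (setT `&` G t)) // setTI.
by congr (Pp _).
Qed.

Lemma forever_cvg0 : Pp (forever Xpf n.+1%:R^-1) @[n --> \oo] --> 0%E.
Proof.
have mF t : measurable (forever Xpf t) by exact: measurable_forever.
have [X0 _ _ _] := hXp.
suff <- : Pp (\bigcap_n forever Xpf n.+1%:R^-1) = 0%E.
  apply: nonincreasing_cvg_mu => //.
  - by rewrite (le_lt_trans (probability_le1 _ (mF _))) ?ltry.
  - exact: bigcapT_measurable.
  - move=> m n mn; apply/subsetPset => w; apply: forever_le.
    by rewrite lef_pV2 ?posrE// ler_nat ltnS.
apply: (subset_measure0 (B := nonneg Xpf 0 1)) => //.
- exact: bigcapT_measurable.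
- exact: measurable_nonneg.
- move=> w H u /andP[]; rewrite le_eqVlt => /orP[/eqP <- _|u0 _].
    by rewrite X0.
  have [n _ /(_ n (leqnn _))] := near_infty_natSinv_lt (PosNum u0).
  by move=> nu; apply: (H n) => //; exact: ltW.
- exact: nonneg_null.
Qed.

(** The probability of agreement up to [t] is the mass of the meet, hence the
same for every such coupling; in the coupling by reflection, disagreement
before [t] forces the first process to be nonnegative after [t]. *)
Lemma mexit_time_gt0 d (Om : measurableType d) (P : probability Om R)
    (Yp Zm : R -> {RV P >-> R}) :
  is_mexit_coupling Xp Xm Yp Zm ->
  {ae P, forall w, (0 < mexit_time Yp Zm w)%E}.
Proof.
move=> [[cYp cZm _ _] HM].
pose t n : R := n.+1%:R^-1; have t0 n : 0 < t n by rewrite invr_gt0.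
pose A n := agree (fun u => Yp u : Om -> R) (fun u => Zm u : Om -> R) (t n).
have mA n : measurable (A n).
  by apply: measurable_agree => // u _; exact: measurable_funPT.
have mG n := measurable_coupling_agree (t n).
have PA n : P (~` A n) = Pp (~` G (t n)).
  have [m [mm Em]] := HM _ (t0 n).
  have [m' [mm' Em']] := reflection_mexit.2 _ (t0 n).
  rewrite !probability_setC//; congr (_ - _)%E.
  have := is_meet_setT mm mm'; rewrite -Em -Em'; exact.
exists (\bigcap_n ~` A n); split.
- by apply: bigcapT_measurable => n; exact: measurableC.
- apply/le_anti; rewrite measure_ge0 andbT.
  have mB : measurable (\bigcap_n ~` A n).
    by apply: bigcapT_measurable => n; exact: measurableC.
  rewrite -(cvg_lim (@ereal_hausdorff R) forever_cvg0).
  apply: lime_ge; first by apply/cvg_ex; exists 0%E; exact: forever_cvg0.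
  apply: nearW => n; apply: (@le_trans _ _ (P (~` A n))).
    apply: le_measure; rewrite ?inE//; first exact: measurableC.
    exact: bigcap_inf.
  rewrite PA; apply: le_measure; rewrite ?inE//; first exact: measurableC.
    exact: measurable_forever.
  by move=> w nG; apply: contrapT => nF; apply: nG; exact: not_forever_agree.
- move=> w /= /negP; rewrite -leNgt => w0 n _ Aw.
  have : ((t n)%:E <= mexit_time Yp Zm w)%E.
    apply: le_ereal_inf_tmp => _ [s [s0 Ys] <-]; rewrite lee_fin leNgt.
    by apply/negP => st; apply: Ys; apply: Aw; rewrite s0.
  by move=> /le_trans /(_ w0); rewrite lee_fin leNgt t0.
Qed.

End mexit.

Theorem theorem29 (R : realType)
    (dp : measure_display) (Omp : measurableType dp) (Pp : probability Omp R)
    (dm : measure_display) (Omm : measurableType dm) (Pm : probability Omm R)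
    (Xp : R -> {RV Pp >-> R}) (Xm : R -> {RV Pm >-> R})
    (hXp : brownian_motion_with_drift 1 Xp)
    (hXm : brownian_motion_with_drift (- 1) Xm) :
  (exists (d : measure_display) (Om : measurableType d) (P : probability Om R)
          (Yp Ym : R -> {RV P >-> R}), is_mexit_coupling Xp Xm Yp Ym) /\
  (forall (d : measure_display) (Om : measurableType d) (P : probability Om R)
          (Yp Ym : R -> {RV P >-> R}), is_mexit_coupling Xp Xm Yp Ym ->
    {ae P, forall w, (0 < mexit_time Yp Ym w)%E}).
Proof.
split; last by move=> d Om P Yp Ym; exact: mexit_time_gt0.
by exists dp, Omp, Pp, Xp, (partner_rv hXp); exact: reflection_mexit.
Qed.
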